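(* Let $p$ be a prime and let $\Gamma=H_1*_K H_2$ be an amalgamated free product, where $H_1,H_2$ are finitely generated nilpotent groups with common subgroup $K$. If both $H_1$ and $H_2$ are $p$-embedded in $\Gamma$ (in particular, if they are $p$-virtual retracts of $\Gamma$), then the natural maps give $\widehat\Gamma_p\cong\widehat{(H_1)}_p\amalg_{\widehat K_p}\widehat{(H_2)}_p$ as a proper pro-$p$ amalgamated free product. Hence, if moreover $\widehat K_p$ is properly contained in $\widehat{(H_i)}_p$ for $i=1,2$, then $\widehat\Gamma_p$ is boundedly generated if and only if $\widehat K_p$ is boundedly generated and $p=[\widehat{(H_1)}_p:\widehat K_p]=[\widehat{(H_2)}_p:\widehat K_p]=2$. In the exceptional case $p=[\widehat{(H_1)}_p:\widehat K_p]=[\widehat{(H_2)}_p:\widehat K_p]=2$, the group $\widehat K_2$ is automatically boundedly generated.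
   Context: $\widehat G_p$ denotes the pro-$p$ completion of an abstract group $G$. The pro-$p$ topology on $G$ has the normal subgroups of finite $p$-power index as a base of neighbourhoods of $1$. A subgroup $S\leq R$ is $p$-embedded in $R$ if for every normal subgroup $U\triangleleft S$ of finite $p$-power index there is a normal subgroup $N\triangleleft R$ of finite $p$-power index with $N\cap S\leq U$. A subgroup $H\leq\Gamma$ is a $p$-virtual retract of $\Gamma$ if there is a subgroup $V$ with $H\leq V\leq\Gamma$ such that $V$ is open in the pro-$p$ topology of $\Gamma$ and $H$ is a retract of $V$. For pro-$p$ groups $G_1,G_2$ with a common closed subgroup $A$, $G_1\amalg_A G_2$ is the pushout of $G_1\leftarrow A\rightarrow G_2$ in the category of pro-$p$ groups; it is proper if the canonical maps $G_i\to G_1\amalg_A G_2$ are injective. The first conclusion includes that the natural maps $\widehat K_p\to\widehat{(H_i)}_p$ are injective, so that $\widehat K_p$ is regarded as a closed subgroup of each $\widehat{(H_i)}_p$. A profinite group $G$ is boundedly generated if $G=\overline{\langle g_1\rangle}\cdots\overline{\langle g_d\rangle}$ for finitely many $g_1,\dots,g_d\in G$. *)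

(* Defs.v *)
From HB Require Import structures.
From mathcomp Require Import all_boot all_classical topology.

Set Implicit Arguments.
Unset Strict Implicit.
Unset Printing Implicit Defensive.

Local Open Scope classical_set_scope.
Local Open Scope card_scope.
Local Open Scope group_scope.

Section Subgroups.
Variable G : groupType.
Implicit Types (A B S N U V : set G) (g : G).

Definition subgroup S := S 1 /\ forall x y, S x -> S y -> S (x / y).

Definition normal_in U S :=
  [/\ subgroup U, U `<=` S & forall x y, S x -> U y -> U (y ^ x)].

Definition lcoset g N : set G := [set g * x | x in N].

Definition has_index S U (n : nat) := [set lcoset g U | g in S] #= `I_n.

Definition p_power_index (p : nat) S U := exists k, has_index S U (p ^ k).

Definition generated A : set G := smallest subgroup A.

Definition powers g : set G := range (fun n => g ^+ n) `|` range (fun n => g ^- n).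

Definition p_normal p N := normal_in N setT /\ p_power_index p setT N.

Definition p_embedded p S :=
  forall U, normal_in U S -> p_power_index p S U ->
  exists2 N, p_normal p N & N `&` S `<=` U.

Definition pro_p_open p A :=
  forall x, A x -> exists2 N, p_normal p N & lcoset x N `<=` A.

Definition retract_of S V :=
  S `<=` V /\ exists r : G -> G,
    [/\ forall x y, V x -> V y -> r (x * y) = r x * r y,
        forall x, V x -> S (r x) & forall x, S x -> r x = x].

Definition p_virtual_retract p S :=
  exists V, [/\ subgroup V, pro_p_open p V & retract_of S V].

End Subgroups.

Definition finitely_generated (G : groupType) :=
  exists s : seq G, generated [set` s] = [set: G].

Section Nilpotent.
Variable G : groupType.

Fixpoint lower_central (n : nat) : set G :=
  if n is n'.+1
  then generated [set [~ x, y] | x in lower_central n' & y in [set: G]]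
  else setT.

Definition nilpotent_group := exists n, lower_central n = [set 1].

End Nilpotent.

Notation group_hom := UMagmaMorphism.type.

(* [Gam] with [h1], [h2] is the pushout of the inclusions [k1], [k2] in groups. *)
Record amalgamated_free_product (K H1 H2 Gam : groupType)
    (k1 : group_hom K H1) (k2 : group_hom K H2)
    (h1 : group_hom H1 Gam) (h2 : group_hom H2 Gam) : Prop :=
  AmalgamatedFreeProduct {
    amalg_inj1 : injective k1;
    amalg_inj2 : injective k2;
    amalg_comm : h1 \o k1 =1 h2 \o k2;
    amalg_univ : forall (G : groupType)
        (f1 : group_hom H1 G) (f2 : group_hom H2 G),
      f1 \o k1 =1 f2 \o k2 ->
      exists f : group_hom Gam G,
        [/\ f \o h1 =1 f1, f \o h2 =1 f2 &
            forall f' : group_hom Gam G,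
              f' \o h1 =1 f1 -> f' \o h2 =1 f2 -> f' =1 f]
  }.

HB.mixin Record isTopologicalGroup G of Topological G & Group G := {
  mulg_continuous : continuous (fun xy : G * G => xy.1 * xy.2);
  invg_continuous : continuous (fun x : G => x^-1)
}.

#[short(type="topologicalGroupType")]
HB.structure Definition TopologicalGroup :=
  {G of Topological G & Group G & isTopologicalGroup G}.

Definition pro_p_group (p : nat) (G : topologicalGroupType) :=
  [/\ compact [set: G], hausdorff_space G, totally_disconnected [set: G] &
      forall N : set G, open N -> normal_in N setT -> p_power_index p setT N].

Definition continuous_hom (G H : topologicalGroupType) (f : G -> H) :=
  continuous f /\ {morph f : x y / x * y}.

Definition boundedly_generated (G : topologicalGroupType) :=
  exists (d : nat) (g : 'I_d -> G), forall x : G,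
  exists2 y : 'I_d -> G, forall i, closure (powers (g i)) (y i)
                       & x = \prod_(i < d) y i.

(* [P] with [j1], [j2] is the pushout of [G1 <- A -> G2] in pro-p groups.
   An injective continuous homomorphism between pro-p groups is an isomorphism
   onto a closed subgroup, so injectivity of [a1] and [a2] makes [A] a common
   closed subgroup of [G1] and [G2]. *)
Record pro_p_amalgam (p : nat) (A G1 G2 P : topologicalGroupType)
    (a1 : A -> G1) (a2 : A -> G2) (j1 : G1 -> P) (j2 : G2 -> P) : Prop :=
  ProPAmalgam {
    pro_p_amalgam_obj : [/\ pro_p_group p A, pro_p_group p G1,
                            pro_p_group p G2 & pro_p_group p P];
    pro_p_amalgam_sub1 : continuous_hom a1 /\ injective a1;
    pro_p_amalgam_sub2 : continuous_hom a2 /\ injective a2;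
    pro_p_amalgam_hom1 : continuous_hom j1;
    pro_p_amalgam_hom2 : continuous_hom j2;
    pro_p_amalgam_comm : j1 \o a1 =1 j2 \o a2;
    pro_p_amalgam_univ : forall (Q : topologicalGroupType)
        (f1 : G1 -> Q) (f2 : G2 -> Q),
      pro_p_group p Q -> continuous_hom f1 -> continuous_hom f2 ->
      f1 \o a1 =1 f2 \o a2 ->
      exists f : P -> Q,
        [/\ continuous_hom f, f \o j1 =1 f1, f \o j2 =1 f2 &
            forall f' : P -> Q, continuous_hom f' ->
              f' \o j1 =1 f1 -> f' \o j2 =1 f2 -> f' =1 f]
  }.

Definition proper_pro_p_amalgam p (A G1 G2 P : topologicalGroupType)
    (a1 : A -> G1) (a2 : A -> G2) (j1 : G1 -> P) (j2 : G2 -> P) :=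
  [/\ pro_p_amalgam p a1 a2 j1 j2, injective j1 & injective j2].

Section CosetTheory.
Variable G : groupType.
Implicit Types (U S N : set G) (g : G).

Lemma subgroupV S x : subgroup S -> S x -> S x^-1.
Proof. by move=> [S1 SF] Sx; have := SF _ _ S1 Sx; rewrite div1g. Qed.

Lemma subgroupM S x y : subgroup S -> S x -> S y -> S (x * y).
Proof.
by move=> sS Sx Sy; have := sS.2 x y^-1 Sx (subgroupV sS Sy); rewrite invgK.
Qed.

Lemma mem_lcoset g N x : lcoset g N x <-> N (g^-1 * x).
Proof.
split=> [[n Nn <-]|Nx]; first by rewrite mulKg.
by exists (g^-1 * x) => //; rewrite mulVKg.
Qed.

Lemma lcoset_refl g N : subgroup N -> lcoset g N g.
Proof. by move=> [N1 _]; exists 1 => //; rewrite mulg1. Qed.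

Lemma eq_lcoset g h N : subgroup N -> lcoset g N = lcoset h N <-> N (g^-1 * h).
Proof.
move=> sN; split=> [e|Ngh].
  by apply/mem_lcoset; rewrite e; apply: lcoset_refl.
apply/seteqP; split=> x /mem_lcoset Nx; apply/mem_lcoset.
  have := subgroupM sN (subgroupV sN Ngh) Nx.
  by rewrite invgM invgK -mulgA mulVKg.
by have := subgroupM sN Ngh Nx; rewrite -mulgA mulVKg.
Qed.

Lemma lcoset1 N : lcoset 1 N = N.
Proof. by apply/seteqP; split=> x => [/mem_lcoset|Nx]; rewrite ?mem_lcoset invg1 mul1g. Qed.

Lemma lcosetM g h N : normal_in N setT ->
  [set x * y | x in lcoset g N & y in lcoset h N] = lcoset (g * h) N.
Proof.
move=> [sN _ nN]; apply/seteqP; split=> [_ [_ [n Nn <-] [_ [m Nm <-] <-]]|].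
  exists (n ^ h * m); first exact: subgroupM (nN _ _ I Nn) Nm.
  by rewrite /conjg !mulgA mulgK.
move=> _ [n Nn <-]; exists g; first exact: lcoset_refl.
by exists (h * n); [exists n | rewrite mulgA].
Qed.

Lemma lcosetV g N : normal_in N setT ->
  [set x^-1 | x in lcoset g N] = lcoset g^-1 N.
Proof.
move=> [sN _ nN]; apply/seteqP; split=> [_ [_ [n Nn <-] <-]|_ [n Nn <-]].
  exists (n^-1 ^ g^-1); first by apply: nN => //; exact: subgroupV.
  by rewrite /conjg invgK !mulgA mulVg mul1g invgM.
exists (n^-1 * g); last by rewrite invgM invgK.
apply/mem_lcoset; rewrite mulgA; have := nN g _ I (subgroupV sN Nn).
by rewrite /conjg mulgA.
Qed.

End CosetTheory.

Lemma card_setX_II T U (A : set T) (B : set U) (a b : nat) :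
  A #= `I_a -> B #= `I_b -> A `*` B #= `I_(a * b).
Proof.
move=> /card_set_bijP[f [fI finj fsurj]] /card_set_bijP[g [gI ginj gsurj]].
apply/card_set_bijP; exists (fun xy => (f xy.1 * b + g xy.2)%N).
split=> [[x y] [/= Ax By]|[x y] [x' y']|n /= nab].
- have := fI x Ax; have := gI y By; move=> /= gb fa.
  by rewrite (leq_trans (n := (f x).+1 * b))// ?leq_mul2r ?fa ?orbT// mulSnr ltn_add2l.
- move=> /set_mem[/= Ax By] /set_mem[/= Ax' By'] e.
  have gb := gI y By; have gb' := gI y' By'.
  have b0 : (0 < b)%N by apply: leq_ltn_trans gb.
  have ef : f x = f x'.
    have := congr1 (divn^~ b) e.
    by rewrite /= !divnMDl// !divn_small// !addn0.
  have eg : g y = g y' by move: e; rewrite ef => /addnI.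
  by congr pair; [apply: finj|apply: ginj] => //; exact: mem_set.
- have b0 : (0 < b)%N by case: b nab {gI ginj gsurj} => //; rewrite muln0.
  have [x Ax fx] := fsurj (n %/ b)%N (ltac:(by rewrite /= ltn_divLR)).
  have [y By gy] := gsurj (n %% b)%N (ltac:(by rewrite /= ltn_mod)).
  by exists (x, y) => //=; rewrite fx gy -divn_eq.
Qed.

Lemma lcoset_eq (G : groupType) (g h : G) (N : set G) :
  subgroup N -> lcoset g N h -> lcoset h N = lcoset g N.
Proof. by move=> sN /mem_lcoset Ngh; apply/esym/eq_lcoset. Qed.

Lemma dvdn_index_preimage (G H : groupType) (phi : group_hom G H) (M : set H) n :
  normal_in M setT -> has_index setT M n ->
  exists2 m, has_index setT (phi @^-1` M) m & m %| n.
Proof.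
move=> nM; have [sM _ cM] := nM.
pose S : set H := [set phi x * m | x in setT & m in M].
have sS : subgroup S.
  split; first by exists 1 => //; exists 1; [case: sM|rewrite gmulf1 mulg1].
  move=> _ _ [x _ [m Mm <-]] [y _ [l Ml <-]].
  exists (x / y) => //; exists ((m / l) ^ (phi y)^-1); first by apply: cM => //; exact: sM.2.
  by rewrite gmulfF /conjg invgK invgM !mulgA mulgVK.
have sP : subgroup (phi @^-1` M).
  split=> [|x y Mx My]; rewrite /preimage/= ?gmulf1 ?gmulfF; [exact: sM.1|exact: sM.2].
have MS m : M m -> S m by move=> Mm; exists 1 => //; exists m; rewrite // gmulf1 mul1g.
have phiS x : S (phi x) by exists x => //; exists 1; [case: sM|rewrite mulg1].
pose E := [set lcoset g S | g in setT].
pose D := [set lcoset g (phi @^-1` M) | g in setT].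
pose C := [set lcoset g M | g in setT]; rewrite /has_index -/C -/D => Cn.
pose r (A : set H) := xget 1 A; pose q (A : set G) := xget 1 A.
have rE g : lcoset (r (lcoset g S)) S = lcoset g S.
  by apply: lcoset_eq => //; exact: xgetI (lcoset_refl g sS).
have qE g : lcoset (q (lcoset g (phi @^-1` M))) (phi @^-1` M) = lcoset g (phi @^-1` M).
  by apply: lcoset_eq => //; exact: xgetI (lcoset_refl g sP).
pose F ED := lcoset (r ED.1 * phi (q ED.2)) M.
have bF : set_bij (E `*` D) C F.
  split.
  - by move=> [A B] _ /=; exists (r A * phi (q B)).
  - move=> [_ _] [_ _] /set_mem/= [[a _ <-] [b _ <-]] /set_mem/= [[a' _ <-] [b' _ <-]].
    rewrite /F/= eq_lcoset// => FM.
    have rS c x : lcoset (c * phi x) S = lcoset c S.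
      by apply/eq_lcoset => //; rewrite invgM mulgVK -gmulfV; exact: phiS.
    have eA : lcoset a S = lcoset a' S.
      rewrite -(rE a) -(rE a') -(rS _ (q (lcoset b (phi @^-1` M)))).
      rewrite -[RHS](rS _ (q (lcoset b' (phi @^-1` M)))).
      by apply/eq_lcoset => //; exact: MS.
    congr pair => //; rewrite -(qE b) -(qE b'); apply/eq_lcoset => //=.
    by move: FM; rewrite eA invgM -mulgA mulKg /preimage/= gmulfM gmulfV.
  - move=> _ [g _ <-].
    have : S ((r (lcoset g S))^-1 * g) by apply/eq_lcoset.
    move=> [x _ [m Mm rxm]].
    exists (lcoset g S, lcoset x (phi @^-1` M)); first by split; [exists g|exists x].
    apply/eq_lcoset => //=; rewrite invgM -mulgA -rxm mulgA.
    apply: subgroupM => //; rewrite -gmulfV -gmulfM.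
    by have /eq_lcoset := qE x; apply.
have EDC : E `*` D #= C by apply/card_set_bijP; exists F.
have fED : finite_set (E `*` D) by exists n; exact: card_eq_trans EDC Cn.
have E0 : E (lcoset 1 S) by exists 1.
have D0 : D (lcoset 1 (phi @^-1` M)) by exists 1.
have fE : finite_set E.
  apply: sub_finite_set (finite_image fst fED) => A EA.
  by exists (A, lcoset 1 (phi @^-1` M)).
have fD : finite_set D.
  apply: sub_finite_set (finite_image snd fED) => B DB.
  by exists (lcoset 1 S, B).
have [a Ea] := fE; have [b Db] := fD; exists b => //.
have /card_eq_II -> : `I_n #= `I_(a * b).
  apply: card_eq_trans (card_esym Cn) _.
  apply: card_eq_trans (card_esym EDC) _; exact: card_setX_II.
exact: dvdn_mull.
Qed.

Section Completion.
Variables (p : nat) (G : groupType).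

Definition p_normal_subgroup := set_type [set N : set G | p_normal p N].

(* G/N is realized as the set of cosets of N, that is, as a set of subsets of G;
   the transition map G/N -> G/M for N <= M sends a coset of N to the coset of M
   containing it. *)
Definition coset_family :=
  prod_topology (fun _ : p_normal_subgroup => discrete_topology (set G)).

Definition coherent : set coset_family :=
  [set x | (forall N, exists g, x N = lcoset g (set_val N)) /\
           forall N M, set_val N `<=` set_val M -> (x N : set G) `<=` x M].

Definition pro_p_completion : Type := set_type coherent.
HB.instance Definition _ := Topological.on pro_p_completion.

Definition component (x : pro_p_completion) (N : p_normal_subgroup) : set G :=
  set_val x N.

Lemma componentP x N : exists g, component x N = lcoset g (set_val N).
Proof. exact: (set_mem (valP x)).1. Qed.

Lemma component_sub x N M : set_val N `<=` set_val M -> component x N `<=` component x M.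
Proof. exact: (set_mem (valP x)).2. Qed.

Lemma component_inj x y : component x = component y -> x = y.
Proof. by move=> e; exact: val_inj. Qed.

Definition of_family (F : p_normal_subgroup -> set G)
    (hF : forall N, exists g, F N = lcoset g (set_val N))
    (sF : forall N M, set_val N `<=` set_val M -> F N `<=` F M) : pro_p_completion :=
  SigSub (mem_set (conj hF sF : coherent (F : coset_family))).

Lemma component_of_family F hF sF : component (@of_family F hF sF) = F.
Proof. by []. Qed.

Lemma p_normal_subgroupP (N : p_normal_subgroup) : p_normal p (set_val N).
Proof. exact: set_mem (valP N). Qed.

Lemma normal_p_normal (N : p_normal_subgroup) : normal_in (set_val N) setT.
Proof. by case: (p_normal_subgroupP N). Qed.

Lemma subgroup_p_normal (N : p_normal_subgroup) : subgroup (set_val N).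
Proof. by case: (normal_p_normal N). Qed.

Definition one_family (N : p_normal_subgroup) : set G := set_val N.

Definition mul_family (x y : pro_p_completion) N : set G :=
  [set a * b | a in component x N & b in component y N].

Definition inv_family (x : pro_p_completion) N : set G :=
  [set a^-1 | a in component x N].

Definition unit_family (g : G) (N : p_normal_subgroup) : set G :=
  lcoset g (set_val N).

Lemma one_familyP N : exists g, one_family N = lcoset g (set_val N).
Proof. by exists 1; rewrite lcoset1. Qed.

Lemma mul_familyP x y N : exists g, mul_family x y N = lcoset g (set_val N).
Proof.
have [g xg] := componentP x N; have [h yh] := componentP y N.
by exists (g * h); rewrite /mul_family xg yh lcosetM//; exact: normal_p_normal.
Qed.

Lemma mul_family_sub x y N M :
  set_val N `<=` set_val M -> mul_family x y N `<=` mul_family x y M.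
Proof.
move=> NM _ [a xa [b yb <-]]; exists a; first exact: component_sub xa.
by exists b => //; exact: component_sub yb.
Qed.

Lemma inv_familyP x N : exists g, inv_family x N = lcoset g (set_val N).
Proof.
have [g xg] := componentP x N.
by exists g^-1; rewrite /inv_family xg lcosetV//; exact: normal_p_normal.
Qed.

Lemma inv_family_sub x N M :
  set_val N `<=` set_val M -> inv_family x N `<=` inv_family x M.
Proof. by move=> NM _ [a xa <-]; exists a => //; exact: component_sub xa. Qed.

Lemma unit_familyP g N : exists h, unit_family g N = lcoset h (set_val N).
Proof. by exists g. Qed.

Lemma unit_family_sub g N M :
  set_val N `<=` set_val M -> unit_family g N `<=` unit_family g M.
Proof. by move=> NM _ [n Nn <-]; exists n => //; exact: NM. Qed.

Definition completion_one : pro_p_completion := of_family one_familyP (fun _ _ => id).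
Definition completion_mul x y : pro_p_completion :=
  of_family (mul_familyP x y) (mul_family_sub (x := x) (y := y)).
Definition completion_inv x : pro_p_completion :=
  of_family (inv_familyP x) (inv_family_sub (x := x)).

Lemma completion_mulA : associative completion_mul.
Proof.
move=> x y z; apply: component_inj; apply/funext => N /=.
rewrite !component_of_family /mul_family !component_of_family /mul_family.
have nN := normal_p_normal N.
have [a ->] := componentP x N; have [b ->] := componentP y N.
by have [c ->] := componentP z N; rewrite !lcosetM// mulgA.
Qed.

Lemma completion_mul1 : left_id completion_one completion_mul.
Proof.
move=> x; apply: component_inj; apply/funext => N /=.
rewrite !component_of_family /mul_family !component_of_family /one_family.
have nN := normal_p_normal N; have [a ->] := componentP x N.
by rewrite -{1}[set_val N]lcoset1 lcosetM// mul1g.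
Qed.

Lemma completion_mulr1 : right_id completion_one completion_mul.
Proof.
move=> x; apply: component_inj; apply/funext => N /=.
rewrite !component_of_family /mul_family !component_of_family /one_family.
have nN := normal_p_normal N; have [a ->] := componentP x N.
by rewrite -{2}[set_val N]lcoset1 lcosetM// mulg1.
Qed.

Lemma completion_mulV : left_inverse completion_one completion_inv completion_mul.
Proof.
move=> x; apply: component_inj; apply/funext => N /=.
rewrite !component_of_family /mul_family !component_of_family /inv_family.
have nN := normal_p_normal N; have [a ->] := componentP x N.
by rewrite lcosetV// lcosetM// mulVg lcoset1.
Qed.

Lemma completion_mulrV : right_inverse completion_one completion_inv completion_mul.
Proof.
move=> x; apply: component_inj; apply/funext => N /=.
rewrite !component_of_family /mul_family !component_of_family /inv_family.
have nN := normal_p_normal N; have [a ->] := componentP x N.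
by rewrite lcosetV// lcosetM// mulgV lcoset1.
Qed.

HB.instance Definition _ := isGroup.Build pro_p_completion
  completion_mulA completion_mul1 completion_mulr1
  completion_mulV completion_mulrV.

Lemma component_mul (x y : pro_p_completion) N :
  component (x * y) N = [set a * b | a in component x N & b in component y N].
Proof. by []. Qed.

Lemma component_inv (x : pro_p_completion) N :
  component x^-1 N = [set a^-1 | a in component x N].
Proof. by []. Qed.

Lemma component_continuous N :
  continuous (fun x : pro_p_completion =>
    component x N : discrete_topology (set G)).
Proof.
move=> x; apply: (@continuous_comp _ coset_family _ set_val (fun y => y N)).
  exact: initial_continuous.
exact: (@proj_continuous p_normal_subgroup (fun=> discrete_topology (set G)) N).
Qed.

Lemma near_component (x : pro_p_completion) N :
  \forall y \near x, component y N = component x N.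
Proof.
have /(_ x) := @component_continuous N.
by move/(_ _ (discrete_set1 _)).
Qed.

Lemma completion_continuous (X : topologicalType) (f : X -> pro_p_completion) :
  (forall x N, \forall y \near x, component (f y) N = component (f x) N) ->
  continuous f.
Proof.
move=> nf; apply: (@continuous_comp_initial _ X coset_family set_val f) => x.
apply/cvg_sup => N; apply/cvg_image.
  by apply/seteqP; split=> // A _; exists (fun=> A).
move=> A Af; exists [set y : coset_family | A (y N)].
  apply: filterS (nf x N) => y /= e; have := nbhs_singleton Af.
  by move: e; rewrite /component /= => ->.
by apply/seteqP; split=> [_ [y Ay <-]//|B AB]; exists (fun=> B).
Qed.

Lemma completion_mul_continuous :
  continuous (fun xy : pro_p_completion * pro_p_completion => xy.1 * xy.2).
Proof.
apply: completion_continuous => -[x y] N.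
exists ([set z | component z N = component x N],
        [set z | component z N = component y N]); first by split; exact: near_component.
by move=> [z t] /= [zx ty]; rewrite !component_mul zx ty.
Qed.

Lemma completion_inv_continuous :
  continuous (fun x : pro_p_completion => x^-1).
Proof.
apply: completion_continuous => x N.
apply: filterS (near_component x N) => y e; rewrite !component_inv.
by rewrite e.
Qed.

HB.instance Definition _ := isTopologicalGroup.Build pro_p_completion
  completion_mul_continuous completion_inv_continuous.

Definition completion_unit (g : G) : pro_p_completion :=
  of_family (unit_familyP g) (unit_family_sub (g := g)).

End Completion.

Section CompletionMap.
Variables (p : nat) (pr_p : prime p) (G H : groupType) (phi : group_hom G H).

Lemma p_normal_preimage (M : set H) : p_normal p M -> p_normal p (phi @^-1` M).
Proof.
move=> [nM [k Mk]]; have [sM _ cM] := nM; split.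
  split=> // [|x y _]; last by rewrite /preimage/= gmulfJ; exact: cM.
  by split=> [|x y]; rewrite /preimage/= ?gmulf1 ?gmulfF; case: sM => // _; exact.
have [m Pm /(dvdn_pfactor _ _ pr_p)[j _ mj]] := dvdn_index_preimage phi nM Mk.
by exists j; rewrite -mj.
Qed.

Definition p_normal_pullback (M : p_normal_subgroup p H) : p_normal_subgroup p G :=
  SigSub (mem_set (p_normal_preimage (p_normal_subgroupP M))).

(* The component at H/M is the image of the component at G/phi^-1(M) under the
   homomorphism G/phi^-1(M) -> H/M induced by phi. *)
Definition map_family (x : pro_p_completion p G) (M : p_normal_subgroup p H) : set H :=
  [set phi a * m | a in component x (p_normal_pullback M) & m in set_val M].

Lemma map_family_lcoset x M g :
  component x (p_normal_pullback M) = lcoset g (phi @^-1` set_val M) ->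
  map_family x M = lcoset (phi g) (set_val M).
Proof.
move=> xg; have sM := subgroup_p_normal M; rewrite /map_family xg.
apply/seteqP; split=> [_ [_ [n Mn <-] [m Mm <-]]|_ [m Mm <-]].
  by exists (phi n * m); [exact: subgroupM|rewrite gmulfM mulgA].
exists g; last by exists m.
by exists 1; rewrite ?mulg1// /preimage/= gmulf1; case: sM.
Qed.

Lemma map_familyP x M : exists h, map_family x M = lcoset h (set_val M).
Proof.
have [g xg] := componentP x (p_normal_pullback M).
by exists (phi g); exact: map_family_lcoset.
Qed.

Lemma map_family_sub x M N :
  set_val M `<=` set_val N -> map_family x M `<=` map_family x N.
Proof.
move=> MN _ [a xa [m Mm <-]]; exists a; last by exists m => //; exact: MN.
by apply: component_sub xa => y; exact: MN.
Qed.

Definition completion_map (x : pro_p_completion p G) : pro_p_completion p H :=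
  of_family (map_familyP x) (map_family_sub (x := x)).

Lemma completion_map_unit g :
  completion_map (completion_unit p g) = completion_unit p (phi g).
Proof.
by apply: component_inj; apply/funext => M; exact: (@map_family_lcoset _ M g).
Qed.

End CompletionMap.

(* Main.v *)
From Pilot Require Import Defs.
From HB Require Import structures.
From mathcomp Require Import all_boot ssralg zmodp fingroup zify.
From mathcomp Require cyclic pgroup.
From mathcomp Require Import all_classical topology.
Import Pilot.Defs.

(** The argument has three parts.

    Completions.  A finitely generated nilpotent group is polycyclic, and every subgroup of it is
    p-embedded ([nilpotent_p_embedded]): given [U] normal of p-power index in [K], a normal subgroup
    [N] maximal for [N `&` K `<=` U] has a finite p-group as quotient, because an element that is central
    modulo [N] must have p-power order and because torsion climbs the upper central series.  The factors
    of an amalgamated product embed in it ([amalgam_inj1]).  Embeddedness turns these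
    inclusions into injections of completions ([completion_map_inj]), and the universal properties of
    the amalgam and of the completion combine into that of the pro-p amalgam ([completed_amalgam]).
    The latter needs the fact that a pro-p group has a base of open normal subgroups at [1].

    Index two implies bounded generation.  As [K] is polycyclic, its completion is a product of
    procyclic groups.  If it has index 2 in both completed factors, it is normal in the completed amalgam with
    a quotient generated by two involutions [a] and [b], so two more procyclic groups suffice, those of
    [a * b] and [a] ([index2_bounded]).

    Bounded generation implies index two.  Let [Q] be a finite p-quotient of the amalgam and let [E], [V1], [V2]
    be the numbers of cosets in [Q] of the images of [K], [H1], [H2]; these count the edges and the vertices
    of a quotient of the Bass-Serre tree.  The kernel of the map to [Q] maps onto the first homology of this
    graph, of rank [E - V1 - V2 + 1].  Instead of the tree, the proof uses the affine action of the amalgam on the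
    group ring of [Q] with coefficients modulo [n], in which [H1] fixes the origin and [H2] fixes the
    indicator function [c] of the image of [K] ([affine_cocycle]).  The kernel acts by translations, at
    least [n ^ (E - V1 - V2)] of them ([translations_bound]).  If all finite p-quotients are products of [r]
    cyclic groups, there are at most [(#|Q| * n) ^ r] translations ([translations_upper]); taking for [n] large
    powers of [p] gives [E <= V1 + V2 + r].  Extending [Q] by the translations multiplies [E], [V1] and [V2] by
    the same large number, whence [E <= V1 + V2] ([index_bound]).  In terms of the indices [e1] and [e2] of
    the image of [K] in those of the factors this says [1 <= 1 / e1 + 1 / e2]; so both are 2 as soon as both
    are larger than 1 ([quotient_index2]), and this passes to the completions ([bounded_index2]). *)

Set Implicit Arguments.
Unset Strict Implicit.
Unset Printing Implicit Defensive.

Local Open Scope classical_set_scope.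
Local Open Scope card_scope.
Local Open Scope group_scope.

(** * Subgroups of finite index and finite quotients *)

Section GroupOnOrdinal.
Variables (n : nat) (mul : 'I_n -> 'I_n -> 'I_n) (one : 'I_n) (inv : 'I_n -> 'I_n).
Hypotheses (mulA : associative mul) (mul1 : left_id one mul) (mulr1 : right_id one mul).
Hypotheses (mulV : left_inverse one inv mul) (mulrV : right_inverse one inv mul).

(** The type of ordinals carrying the given group law; the laws are parameters of the alias so
    that canonical inference can find them in it. *)
Definition ordinal_group of associative mul & left_id one mul & right_id one mul &
  left_inverse one inv mul & right_inverse one inv mul : Type := 'I_n.
Local Notation T := (ordinal_group mulA mul1 mulr1 mulV mulrV).
HB.instance Definition _ := Finite.copy T 'I_n.
HB.instance Definition _ := isGroup.Build T mulA mul1 mulr1 mulV mulrV.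

Lemma finGroup_of_ordinal : exists (Q : finGroupType) (f : 'I_n -> Q),
  [/\ bijective f, {morph f : x y / mul x y >-> x * y} & #|Q| = n].
Proof.
exists (T : finGroupType), id; split => //; first by exists id.
exact: card_ord.
Qed.
End GroupOnOrdinal.

Section FiniteIndex.
Variable G : groupType.
Implicit Types (S T A B U V N : set G) (g x y : G).

(** Finite index as a covering by finitely many left cosets, a form that composes directly. *)
Definition finite_index S A :=
  exists s : seq G, forall x, S x -> exists2 g, g \in s & A (g^-1 * x).

Lemma normal_subgroup U S : normal_in U S -> subgroup U. Proof. by case. Qed.

Lemma subgroupX S x n : subgroup S -> S x -> S (x ^+ n).
Proof.
move=> sS Sx; elim: n => [|n IH]; first by rewrite expg0; case: sS.
by rewrite expgS; apply: subgroupM.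
Qed.

Lemma subgroupT : subgroup [set: G]. Proof. by []. Qed.

Lemma subgroupI A B : subgroup A -> subgroup B -> subgroup (A `&` B).
Proof.
by move=> [A1 AF] [B1 BF]; split=> // x y [Ax Bx] [Ay By]; split; [apply: AF|apply: BF].
Qed.

Lemma finite_index_trans S T A :
  finite_index S T -> finite_index T A -> finite_index S A.
Proof.
move=> [s sP] [t tP]; exists [seq g * h | g <- s, h <- t] => x /sP[g gs /tP[h ht Ah]].
by exists (g * h); [exact: allpairs_f|rewrite invgM -mulgA].
Qed.

Lemma finite_indexI S A B : subgroup A -> subgroup B ->
  finite_index S A -> finite_index S B -> finite_index S (A `&` B).
Proof.
move=> sA sB [s sP] [t tP].
pose z g h := xget 1 [set z | A (g^-1 * z) /\ B (h^-1 * z)].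
exists [seq z g h | g <- s, h <- t] => x Sx.
have [g gs Ag] := sP x Sx; have [h ht Bh] := tP x Sx.
exists (z g h); first exact: allpairs_f.
have [Az Bz] : [set z | A (g^-1 * z) /\ B (h^-1 * z)] (z g h) by exact: (@xgetI _ _ _ x).
split.
  have := subgroupM sA (subgroupV sA Az) Ag.
  by rewrite invgM invgK -mulgA mulVKg.
have := subgroupM sB (subgroupV sB Bz) Bh.
by rewrite invgM invgK -mulgA mulVKg.
Qed.

Lemma has_index_finite S U n : subgroup U -> has_index S U n -> finite_index S U.
Proof.
move=> sU /card_set_bijP[f [fI finj fsurj]].
pose P i : set G := [set g | S g /\ f (lcoset g U) = i].
exists [seq xget 1 (P i) | i <- iota 0 n] => x Sx.
exists (xget 1 (P (f (lcoset x U)))).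
  by apply: map_f; rewrite mem_iota /= add0n; apply: fI; exists x.
have : P (f (lcoset x U)) (xget 1 (P (f (lcoset x U)))) by exact: (@xgetI _ _ _ x).
move=> [Sh fh]; apply/(eq_lcoset _ _ sU); apply: finj => //; apply/mem_set.
  by exists (xget 1 (P (f (lcoset x U)))).
by exists x.
Qed.

Lemma finite_has_index S U : subgroup U ->
  finite_index S U -> exists n, has_index S U n.
Proof.
move=> sU [s sP].
suff : finite_set [set lcoset g U | g in S] by [].
apply: (@sub_finite_set _ _ [set lcoset g U | g in [set` s]]).
  move=> _ [x Sx <-]; have [g gs Ug] := sP x Sx; exists g => //.
  exact/eq_lcoset.
exact/finite_image/finite_seq.
Qed.

(** The quotient [S / U] is transported to the ordinals that number the cosets. *)
Lemma finite_quotient S U n : subgroup S -> normal_in U S -> has_index S U n ->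
  exists (Q : finGroupType) (q : G -> Q),
    [/\ forall x y, S x -> S y -> q (x * y) = q x * q y,
        forall z, exists2 x, S x & q x = z,
        forall x, S x -> (q x = 1 <-> U x) & #|Q| = n].
Proof.
move=> sS nU /card_set_bijP[f [fI finj fsurj]].
have [sU US cU] := nU.
case: n fI finj fsurj => [fI|n fI finj fsurj].
  by have /fI : [set lcoset g U | g in S] (lcoset 1 U) by exists 1 => //; case: sS.
pose c x : 'I_n.+1 := inord (f (lcoset x U)).
have cE x y : S x -> S y -> c x = c y <-> U (x^-1 * y).
  move=> Sx Sy; rewrite -(eq_lcoset _ _ sU); split=> [|e]; last by rewrite /c e.
  move=> /(congr1 val) /=; rewrite !inordK; [|by apply: fI; exists y|by apply: fI; exists x].
  by move=> e; apply: finj => //; apply/mem_set; [exists x|exists y].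
have csurj (i : 'I_n.+1) : exists x, S x /\ c x = i.
  have [_ [x Sx <-] fx] := fsurj i (ltn_ord i).
  by exists x; split=> //; rewrite /c fx inord_val.
pose r i := projT1 (cid (csurj i)).
have Sr i : S (r i) by rewrite /r; case: cid => x [].
have cr i : c (r i) = i by rewrite /r; case: cid => x [].
have cM x y : S x -> S y -> c (r (c x) * r (c y)) = c (x * y).
  move=> Sx Sy; apply/cE; try exact: subgroupM.
  have : U ((r (c x))^-1 * x) by apply/cE.
  have : U ((r (c y))^-1 * y) by apply/cE.
  move=> Uy Ux.
  have := subgroupM sU (cU _ _ (Sr (c y)) Ux) Uy.
  by rewrite conjgE invgM !mulgA mulgK.
pose mul i j := c (r i * r j); pose one := c 1; pose inv i := c (r i)^-1.
have S1 : S 1 by case: sS.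
have SV x : S x -> S x^-1 by exact: subgroupV.
have SM x y : S x -> S y -> S (x * y) by exact: subgroupM.
have [||||//|Q [g [bg gM cardQ]]] := @finGroup_of_ordinal n.+1 mul one inv.
- move=> i j k; rewrite /mul -[in LHS](cr i) -[in RHS](cr k).
  by rewrite !cM ?mulgA//; exact: SM.
- by move=> i; rewrite /mul /one -[in LHS](cr i) cM// mul1g cr.
- by move=> i; rewrite /mul /one -[in LHS](cr i) cM// mulg1 cr.
- by move=> i; rewrite /mul /inv /one -[X in _ * r X](cr i) cM ?mulVg//; exact: SV.
- by move=> i; rewrite /mul /inv /one -[X in r X * _](cr i) cM ?mulgV//; exact: SV.
exists Q, (g \o c); split=> //=.
- by move=> x y Sx Sy; rewrite -gM /mul cM.
- move=> z; have [g' gK g'K] := bg; exists (r (g' z)) => //.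
  by rewrite cr g'K.
- move=> x Sx; have -> : 1 = g (c 1) :> Q.
    apply: (@mulgI _ (g (c 1))); rewrite mulg1 -gM /mul cM// mulg1.
    by [].
  split=> [/(bij_inj bg)/esym/cE|Ux]; first by rewrite invg1 mul1g; apply.
  by congr g; apply/esym/cE => //; rewrite invg1 mul1g.
Qed.

(** Lagrange's theorem gives one direction; conversely, by Cauchy's theorem a finite group
    in which all elements have p-power order is a p-group.  Finiteness and torsion pass to
    intersections and to preimages more easily than the index itself. *)
Lemma p_power_indexP p S U : prime p -> subgroup S -> normal_in U S ->
  p_power_index p S U <->
  finite_index S U /\ forall x, S x -> exists e, U (x ^+ (p ^ e)).
Proof.
move=> pr_p sS nU; have sU := normal_subgroup nU.
have qX (Q : finGroupType) (q : G -> Q) :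
    (forall x y, S x -> S y -> q (x * y) = q x * q y) ->
    forall x n, S x -> q (x ^+ n) = q x ^+ n.
  move=> qM x n Sx; elim: n => [|n IH]; last by rewrite !expgS qM ?IH//; exact: subgroupX.
  apply: (@mulgI _ (q 1)); rewrite !expg0 mulg1 -qM ?mulg1//; by case: sS.
split=> [[k Uk]|[/(finite_has_index sU)[n Un] tor]].
  split=> [|x Sx]; first exact: has_index_finite Uk.
  have [Q [q [qM qS qK cQ]]] := finite_quotient sS nU Uk.
  exists k; apply/qK; first exact: subgroupX.
  by rewrite qX// -cQ -cardsT; apply: cyclic.expg_cardG; rewrite inE.
have [Q [q [qM qS qK cQ]]] := finite_quotient sS nU Un.
have n_gt0 : (0 < n)%N by rewrite -cQ; apply/card_gt0P; exists 1.
have : p.-nat n.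
  apply/pnatP => // r pr_r; rewrite -cQ -cardsT => /(pgroup.Cauchy (G := [set: Q]%G) pr_r)[z _ oz].
  have [x Sx qx] := qS z; have [e Ue] := tor x Sx.
  have : q (x ^+ (p ^ e)) = 1 by apply/qK => //; exact: subgroupX.
  rewrite qX// qx => /eqP; rewrite -cyclic.order_dvdn oz.
  by case: e {Ue} => [|e]; [rewrite dvdn1; case: r pr_r {oz} => [|[|]]|rewrite Euclid_dvdX// dvdn_prime2// => /andP[]].
by move=> /p_natP[k nk]; exists k; rewrite -nk.
Qed.

End FiniteIndex.
Arguments subgroupT {G}.

(** * Virtual retracts in the pro-p topology *)

Section ProPTopology.
Variables (p : nat) (pr_p : prime p) (G : groupType).
Implicit Types (S U V N M : set G).

Lemma p_normalP N : p_normal p N <->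
  [/\ normal_in N setT, finite_index setT N & forall x, exists e, N (x ^+ (p ^ e))].
Proof.
split=> [[nN /(p_power_indexP pr_p subgroupT nN)[fN tN]]|[nN fN tN]].
  by split=> // x; exact: tN.
by split=> //; apply/(p_power_indexP pr_p subgroupT nN); split.
Qed.

Lemma p_power_le N x e e' : subgroup N -> (e <= e')%N -> N (x ^+ (p ^ e)) -> N (x ^+ (p ^ e')).
Proof.
by move=> sN le Nx; rewrite -(subnKC le) expnD expgnA; exact: subgroupX.
Qed.

Lemma normalI N M : normal_in N [set: G] -> normal_in M [set: G] -> normal_in (N `&` M) setT.
Proof.
move=> [sN _ cN] [sM _ cM]; split=> // [|x y _ [Ny My]]; first exact: subgroupI.
by split; [apply: cN|apply: cM].
Qed.

Lemma p_normalI N M : p_normal p N -> p_normal p M -> p_normal p (N `&` M).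
Proof.
move=> /p_normalP[nN fN tN] /p_normalP[nM fM tM]; apply/p_normalP.
have sN := normal_subgroup nN; have sM := normal_subgroup nM.
split=> [||x]; [exact: normalI|exact: finite_indexI|].
have [e Ne] := tN x; have [e' Me'] := tM x; exists (maxn e e'); split.
  exact: p_power_le (leq_maxl _ _) Ne.
exact: p_power_le (leq_maxr _ _) Me'.
Qed.

Lemma p_normalT : p_normal p [set: G].
Proof.
apply/p_normalP; split=> // [|x]; last by exists 0.
by exists [:: 1] => x _; exists 1 => //; rewrite inE.
Qed.

(** Transitivity of the condition of being open in the pro-p topology, for normal subgroups. *)
Lemma p_normal_core N M : p_normal p N -> normal_in M [set: G] ->
  finite_index N M -> (forall x, N x -> exists e, M (x ^+ (p ^ e))) -> p_normal p M.
Proof.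
move=> /p_normalP[nN fN tN] nM fM tM; apply/p_normalP; split=> //.
  exact: finite_index_trans fM.
move=> x; have [e Ne] := tN x; have [e' Me'] := tM _ Ne.
by exists (e + e')%N; rewrite expnD expgnA.
Qed.

(** Let [r] be the retraction of the open subgroup [V] onto [S] and let [N0] be an open normal
    subgroup inside [V].  The required normal subgroup is the intersection of all the
    conjugates of the intersection of [N0] and [r^-1(U)].  Only finitely many of them differ,
    because [r^-1(U)] is normal in [V], so the index remains a power of [p]; and an element
    of [S] in this intersection lies in [U] because [r] fixes it. *)
Lemma p_virtual_retract_embedded S :
  subgroup S -> p_virtual_retract p S -> p_embedded p S.
Proof.
move=> sS [V [sV oV [SV [r [rM rS rid]]]]] U nU pU.
have [sU US cU] := nU.
have [fU tU] := (p_power_indexP pr_p sS nU).1 pU.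
have V1 : V 1 by case: sV.
have [N0 pN0] := oV 1 V1; rewrite lcoset1 => N0V.
have [nN0 fN0 tN0] := (p_normalP _).1 pN0; have [sN0 _ cN0] := nN0.
have S1 : S 1 by case: sS.
have r1 : r 1 = 1 by apply: rid.
have rV x : V x -> r x^-1 = (r x)^-1.
  move=> Vx; apply: (@mulgI _ (r x)); rewrite mulgV -rM ?mulgV//.
  exact: subgroupV.
have rX x n : V x -> r (x ^+ n) = r x ^+ n.
  by move=> Vx; elim: n => [//|n IH]; rewrite !expgS rM ?IH//; exact: subgroupX.
have rJ x n : V x -> V n -> r (x ^ n) = r x ^ r n.
  move=> Vx Vn; rewrite !conjgE rM ?rM ?rV//; last exact: subgroupM.
  exact: subgroupV.
have N0VJ x g : N0 x -> V (x ^ g) by move=> N0x; apply: N0V; exact: cN0.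
pose N := [set x | N0 x /\ forall g, U (r (x ^ g))].
have nN : normal_in N setT.
  split=> // [|x y _ [N0y Uy]]; last first.
    by split=> [|g]; [exact: cN0|rewrite -conjgM; exact: Uy].
  split=> [|x y [N0x Ux] [N0y Uy]].
    by split=> [|g]; [case: sN0|rewrite conj1g r1; case: sU].
  split=> [|g]; first exact: sN0.2.
  rewrite conjMg conjVg rM ?rV; try exact: N0VJ; last exact/(subgroupV sV)/N0VJ.
  exact: sU.2.
(* conjugating by the coset representatives [s] of [N0] is enough to define [N] *)
have [s sP] := fN0.
have tN x : N0 x -> exists e, N (x ^+ (p ^ e)).
  move=> N0x.
  suff [e He] : exists e, forall g, g \in s -> U (r ((x ^+ (p ^ e)) ^ g)).
    exists e; split=> [|g]; first exact: subgroupX.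
    have [h hs N0g] := sP g I.
    rewrite -(mulVKg h g) conjgM rJ; [|by apply: N0VJ; exact: subgroupX|exact: N0V].
    by apply: cU; [exact/rS/N0V|exact: He].
  elim: s {sP} => [|g s [e He]]; first by exists 0%N.
  have [e' He'] := tU (r (x ^ g)) (rS _ (N0VJ _ _ N0x)).
  exists (maxn e e') => h; rewrite inE => /orP[/eqP->|hs].
    rewrite conjXg rX; last exact: N0VJ.
    exact: p_power_le (leq_maxr _ _) He'.
  have := He h hs; rewrite !conjXg !rX; try exact: N0VJ.
  exact: p_power_le (leq_maxl _ _).
have fN : finite_index N0 N.
  suff [s' s'P] : finite_index N0 [set x | N0 x /\ forall g, g \in s -> U (r (x ^ g))].
    exists s' => x /s'P[g gs' [N0g Ug]]; exists g => //; split=> // h.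
    have [k ks N0h] := sP h I.
    rewrite -(mulVKg k h) conjgM rJ; [|exact: N0VJ|exact: N0V].
    by apply: cU; [exact/rS/N0V|exact: Ug].
  elim: s {sP} => [|g s IH]; first by exists [:: 1] => x N0x; exists 1; rewrite ?inE// invg1 mul1g.
  have -> : [set x | N0 x /\ forall h, h \in g :: s -> U (r (x ^ h))] =
      [set x | N0 x /\ forall h, h \in s -> U (r (x ^ h))] `&`
      [set x | N0 x /\ U (r (x ^ g))].
    apply/seteqP; split=> [x [N0x Ux]|x [[N0x Ux] [_ Ug]]].
      by split; split=> //; [move=> h hs; exact/Ux/mem_behead|exact/Ux/mem_head].
    by split=> // h; rewrite inE => /orP[/eqP->//|]; exact: Ux.
  have sub (P : G -> Prop) : subgroup [set x | N0 x /\ forall h, P h -> U (r (x ^ h))].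
    split=> [|x y [N0x Ux] [N0y Uy]].
      by split=> [|h _]; [case: sN0|rewrite conj1g r1; case: sU].
    split=> [|h Ph]; first exact: sN0.2.
    rewrite conjMg conjVg rM ?rV; try exact: N0VJ; last exact/(subgroupV sV)/N0VJ.
    by apply: sU.2; [exact: Ux|exact: Uy].
  apply: finite_indexI => //.
    have -> : [set x | N0 x /\ U (r (x ^ g))] =
        [set x | N0 x /\ forall h, h = g -> U (r (x ^ h))].
      by apply/seteqP; split=> x [N0x Ux]; split=> //; [move=> _ ->|exact: Ux].
    exact: (sub (eq^~ g)).
  have [t tP] := fU.
  exists [seq xget 1 [set z | N0 z /\ U (h^-1 * r (z ^ g))] | h <- t] => x N0x.
  have [h ht Uh] := tP _ (rS _ (N0VJ _ g N0x)).
  exists (xget 1 [set z | N0 z /\ U (h^-1 * r (z ^ g))]); first exact: map_f.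
  have [N0z Uz] : [set z | N0 z /\ U (h^-1 * r (z ^ g))] (xget 1 [set z | N0 z /\ U (h^-1 * r (z ^ g))]).
    exact: (@xgetI _ _ _ x).
  split; first by apply: subgroupM => //; exact: subgroupV.
  rewrite conjMg conjVg rM ?rV; try exact: N0VJ; last exact/(subgroupV sV)/N0VJ.
  have := subgroupM sU (subgroupV sU Uz) Uh.
  by rewrite invgM invgK -mulgA mulVKg.
exists N; first exact: p_normal_core fN tN.
move=> x [[N0x Ux] Sx]; rewrite -(rid x Sx) -(conjg1 x).
exact: Ux.
Qed.

End ProPTopology.

(** * Actions of amalgamated products *)

Section Symmetric.
Variable X : Type.

Record symmetry := Symmetry {
  sym_fun : X -> X; sym_inv : X -> X;
  sym_funK : cancel sym_fun sym_inv; sym_invK : cancel sym_inv sym_fun }.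

HB.instance Definition _ := gen_eqMixin symmetry.
HB.instance Definition _ := gen_choiceMixin symmetry.

Lemma symmetry_eq (f g : symmetry) : sym_fun f =1 sym_fun g -> f = g.
Proof.
case: f g => [f f' fK f'K] [g g' gK g'K] /= /funext e; subst g.
have e : f' = g' by apply/funext => x; rewrite -{1}(g'K x) fK.
by subst g'; congr Symmetry; exact: Prop_irrelevance.
Qed.

Definition symmetry_one := Symmetry (fun=> erefl) (fun=> erefl : id _ = _).
Definition symmetry_mul f g :=
  Symmetry (can_comp (sym_funK f) (sym_funK g)) (can_comp (sym_invK g) (sym_invK f)).
Definition symmetry_inv f := Symmetry (sym_invK f) (sym_funK f).

Lemma symmetry_mulA : associative symmetry_mul. Proof. by move=> *; exact: symmetry_eq. Qed.
Lemma symmetry_mul1 : left_id symmetry_one symmetry_mul. Proof. by move=> *; exact: symmetry_eq. Qed.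
Lemma symmetry_mulr1 : right_id symmetry_one symmetry_mul. Proof. by move=> *; exact: symmetry_eq. Qed.
Lemma symmetry_mulV : left_inverse symmetry_one symmetry_inv symmetry_mul.
Proof. by move=> f; apply: symmetry_eq => x /=; rewrite sym_funK. Qed.
Lemma symmetry_mulrV : right_inverse symmetry_one symmetry_inv symmetry_mul.
Proof. by move=> f; apply: symmetry_eq => x /=; rewrite sym_invK. Qed.

HB.instance Definition _ :=
  isGroup.Build symmetry symmetry_mulA symmetry_mul1 symmetry_mulr1 symmetry_mulV symmetry_mulrV.

End Symmetric.

Definition is_left_action (G : groupType) X (a : G -> X -> X) :=
  a 1 =1 id /\ forall x y z, a (x * y) z = a x (a y z).

Lemma left_actionK (G : groupType) X (a : G -> X -> X) x :
  is_left_action a -> cancel (a x) (a x^-1).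
Proof. by move=> [a1 aM] z; rewrite -aM mulVg a1. Qed.

Lemma hom_pack (G H : groupType) (f : G -> H) : {morph f : x y / x * y} ->
  exists g : group_hom G H, g =1 f.
Proof.
move=> fM; have fF : {morph f : x y / x / y}.
  have f1 : f 1 = 1 by apply: (@mulgI _ (f 1)); rewrite -fM !mulg1.
  have fV x : f x^-1 = (f x)^-1 by apply: (@mulgI _ (f x)); rewrite -fM !mulgV.
  by move=> x y; rewrite fM fV.
pose F : group_hom G H := HB.pack f (isGroupMorphism.Build G H f fF).
by exists F.
Qed.

Lemma action_hom (G : groupType) X (a : G -> X -> X) : is_left_action a ->
  exists f : group_hom G (symmetry X), forall x, sym_fun (f x) = a x.
Proof.
move=> aa; have [a1 aM] := aa.
have aVK x : cancel (a x^-1) (a x).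
  by move=> z; rewrite -aM mulgV a1.
pose f x := Symmetry (left_actionK x aa) (aVK x).
have [//|g gE] := @hom_pack _ _ f.
  by move=> x y; apply: symmetry_eq => z /=; exact: aM.
by exists g => x; rewrite gE.
Qed.

Section Amalgam.
Variables (K H1 H2 Gam : groupType).
Variables (k1 : group_hom K H1) (k2 : group_hom K H2).
Variables (h1 : group_hom H1 Gam) (h2 : group_hom H2 Gam).
Hypothesis amalgam : amalgamated_free_product k1 k2 h1 h2.

(** The universal property, applied to the group of permutations of [X]: it is used only
    through the actions that it produces. *)
Lemma amalgam_action X (a1 : H1 -> X -> X) (a2 : H2 -> X -> X) :
  is_left_action a1 -> is_left_action a2 ->
  (forall k x, a1 (k1 k) x = a2 (k2 k) x) ->
  exists2 a : Gam -> X -> X, is_left_action a &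
    (forall h, a (h1 h) =1 a1 h) /\ (forall h, a (h2 h) =1 a2 h).
Proof.
move=> /action_hom[f1 f1E] /action_hom[f2 f2E] e.
have [|f [fh1 fh2 _]] := amalg_univ amalgam (f1 := f1) (f2 := f2).
  by move=> k /=; apply: symmetry_eq => x; rewrite f1E f2E e.
exists (fun g => sym_fun (f g)).
  by split=> [x|x y z]; rewrite ?gmulf1 ?gmulfM.
by split=> h x; [have /= -> := fh1 h; rewrite f1E|have /= -> := fh2 h; rewrite f2E].
Qed.

Lemma amalgam_hom_ext (G : groupType) (f f' : Gam -> G) :
  {morph f : x y / x * y} -> {morph f' : x y / x * y} ->
  f \o h1 =1 f' \o h1 -> f \o h2 =1 f' \o h2 -> f =1 f'.
Proof.
move=> /hom_pack[g gE] /hom_pack[g' gE'] e1 e2 x.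
have [|h [_ _ u]] := amalg_univ amalgam (f1 := g \o h1) (f2 := g \o h2).
  by move=> k /=; congr (g _); exact: (amalg_comm amalgam).
rewrite -gE -gE' (u g)// [RHS](u g')// => y /=.
  by rewrite gE' gE; have /= -> := e1 y.
by rewrite gE' gE; have /= -> := e2 y.
Qed.

(** Let [Gam] act on its subsets and on one extra point [None], and let [s] exchange the subset
    [S] with [None].  The images of the factors commute with [s]; by the uniqueness in the universal
    property, so does [Gam].  Since [Gam] fixes [None], it fixes [S]. *)
Lemma amalgam_generated (S : set Gam) : subgroup S ->
  (forall x, S (h1 x)) -> (forall x, S (h2 x)) -> forall x, S x.
Proof.
move=> sS Sh1 Sh2 x.
pose a (g : Gam) (A : option (set Gam)) := omap (lcoset g) A.
have aP : is_left_action a.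
  split=> [[A|]//=|g h [A|]//=].
    by rewrite lcoset1.
  congr Some; apply/seteqP; split=> z.
    by move=> [y Ay <-]; exists (h * y); [exists y|rewrite mulgA].
  by move=> [_ [y Ay <-] <-]; exists y => //; rewrite mulgA.
pose s (A : option (set Gam)) :=
  if `[< A = Some S >] then None else if A is None then Some S else A.
have sN : s None = Some S by rewrite /s; case: asboolP.
have sS0 : s (Some S) = None by rewrite /s; case: asboolP.
have sA A : A <> S -> s (Some A) = Some A.
  by move=> nA; rewrite /s; case: asboolP => // -[].
have sK : involutive s.
  move=> [A|]; last by rewrite sN sS0.
  by have [->|nA] := EM (A = S); [rewrite sS0 sN|rewrite !sA].
have sa g : S g -> forall A, a g (s A) = s (a g A).
  move=> Sg; have gS : lcoset g S = S.
    by rewrite -[RHS]lcoset1; apply/eq_lcoset => //; rewrite mulg1; exact: subgroupV.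
  have sub A B : lcoset g A = lcoset g B -> A `<=` B.
    move=> e y Ay; have : lcoset g B (g * y) by rewrite -e; exists y.
    by move=> [z Bz /mulgI <-].
  have gSE A : lcoset g A = S <-> A = S.
    split=> [e|->//]; rewrite -{}[RHS]gS in e.
    by apply/seteqP; split; exact: sub.
  move=> [A|]; last by rewrite /= sN /= gS.
  have [->|nA] := EM (A = S); first by rewrite sS0 /= gS sS0.
  by rewrite sA//= sA// => /gSE.
have bP : is_left_action (fun g => s \o a g \o s).
  by split=> [A|g h A] /=; rewrite ?aP.1 ?sK// aP.2.
have [f fE] := action_hom aP; have [g gE] := action_hom bP.
have fg : f =1 g.
  apply: amalgam_hom_ext; try exact: gmulfM.
    by move=> h /=; apply: symmetry_eq => A; rewrite fE gE /= sa// sK.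
  by move=> h /=; apply: symmetry_eq => A; rewrite fE gE /= sa// sK.
have := congr1 (fun f => sym_fun f None) (fg x); rewrite fE gE /= sN /=.
have [<- _|nS] := EM (lcoset x S = S); first exact: lcoset_refl.
by rewrite sA.
Qed.

End Amalgam.

Section AmalgamInjective.
Variables (K H1 H2 Gam : groupType).
Variables (k1 : group_hom K H1) (k2 : group_hom K H2).
Variables (h1 : group_hom H1 Gam) (h2 : group_hom H2 Gam).
Hypothesis amalgam : amalgamated_free_product k1 k2 h1 h2.

(** The [K]-component of an element with respect to a fixed choice of right coset
    representatives. *)
Lemma coset_coordinate (H : groupType) (k : group_hom K H) : injective k ->
  exists c : H -> K, forall a x, c (k a * x) = a * c x.
Proof.
move=> kI; pose C x := [set y : H | exists a, y = k a * x].
pose r x := xget 1 (C x).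
have rP x : exists a, x = k a * r x.
  have [a ra] : C x (r x) by apply: (@xgetI _ _ _ x); exists 1; rewrite gmulf1 mul1g.
  by exists a^-1; rewrite ra gmulfV mulKg.
have rM a x : r (k a * x) = r x.
  rewrite /r; congr xget; apply/seteqP; split=> _ [b ->].
    by exists (b * a); rewrite gmulfM mulgA.
  by exists (b * a^-1); rewrite gmulfM gmulfV mulgA mulgVK.
pose c x := projT1 (cid (rP x)).
have cP x : x = k (c x) * r x by rewrite /c; case: cid.
exists c => a x; apply: kI.
have := cP (k a * x); rewrite rM {1}(cP x) mulgA => /mulIg <-.
by rewrite gmulfM.
Qed.

(** [H1] acts on [H1 * H2] by translation of the first coordinate.  Writing
    [x = k1 a * r] and [y = k2 b * s] with fixed representatives [r] and [s], the
    involution [theta] that exchanges [a] and [b] turns the translation of the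
    second coordinate by [K] into that of the first.  So the conjugate by
    [theta] of the action of [H2] on the second coordinate agrees on [K] with the action of
    [H1], which is faithful. *)
Lemma amalgam_inj1 : injective h1.
Proof.
have [c1 c1P] := coset_coordinate (amalg_inj1 amalgam).
have [c2 c2P] := coset_coordinate (amalg_inj2 amalgam).
pose X := (H1 * H2)%type.
pose theta (z : X) : X :=
  (k1 (c2 z.2 * (c1 z.1)^-1) * z.1, k2 (c1 z.1 * (c2 z.2)^-1) * z.2).
have thetaK : involutive theta.
  move=> [x y]; rewrite /theta /= !c1P !c2P !mulgVK.
  by rewrite !mulgA -!gmulfM !mulgA !mulgVK !mulgV !gmulf1 !mul1g.
pose a1 (h : H1) (z : X) : X := (h * z.1, z.2).
pose b (h : H2) (z : X) : X := (z.1, h * z.2).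
have [||k [x y]|a aP [ah1 _]] := @amalgam_action _ _ _ _ _ _ _ _ amalgam X a1 (fun h => theta \o b h \o theta).
- by split=> [[x y]|g h [x y]]; rewrite /a1 /= ?mul1g ?mulgA.
- by split=> [z|g h z] /=; rewrite ?thetaK /b /= ?mul1g -?mulgA -?surjective_pairing ?thetaK.
- rewrite -[LHS]thetaK /=; congr theta; rewrite /theta /a1 /b /= !c1P.
  by rewrite !invgM !mulgA -!gmulfM !mulgA mulgVK.
move=> x y e; have := ah1 x (1, 1); rewrite e ah1 /a1 /= !mulg1.
by case.
Qed.

End AmalgamInjective.

Lemma amalgam_sym (K H1 H2 Gam : groupType)
    (k1 : group_hom K H1) (k2 : group_hom K H2)
    (h1 : group_hom H1 Gam) (h2 : group_hom H2 Gam) :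
  amalgamated_free_product k1 k2 h1 h2 -> amalgamated_free_product k2 k1 h2 h1.
Proof.
move=> [i1 i2 c u]; split=> // G f1 f2 e.
have [|f [e1 e2 uf]] := u G f2 f1; first by move=> x; rewrite e.
by exists f; split=> // f' e1' e2'; exact: uf.
Qed.

(** * Polycyclic groups *)

Section Congruence.
Variable G : groupType.
Implicit Types (S T N : set G) (x y z t : G).

Lemma coset_congM T S a b c d : normal_in T S -> S c ->
  T (a^-1 * b) -> T (c^-1 * d) -> T ((a * c)^-1 * (b * d)).
Proof.
move=> [sT _ nT] Sc Tab Tcd; have := subgroupM sT (nT _ _ Sc Tab) Tcd.
by rewrite conjgE invgM !mulgA mulgK.
Qed.

Lemma coset_congV T S a b : normal_in T S -> subgroup S -> S b ->
  T (a^-1 * b) -> T (a * b^-1).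
Proof.
move=> [sT _ nT] sS Sb Tab.
have := nT _ _ (subgroupV sS Sb) (subgroupV sT Tab).
by rewrite conjgE !invgM !invgK mulgA mulVKg.
Qed.

Lemma coset_congX T S a b n : normal_in T S -> subgroup S -> S a ->
  T (a^-1 * b) -> T ((a ^+ n)^-1 * b ^+ n).
Proof.
move=> nT sS Sa Tab; elim: n => [|n IH].
  by rewrite !expg0 invg1 mulg1; case: nT => -[].
by rewrite !expgS; apply: (coset_congM nT) => //; exact: subgroupX.
Qed.

Lemma coset_cong_mem T a b : subgroup T -> T (a^-1 * b) -> T a <-> T b.
Proof.
move=> sT Tab; split=> [Ta|Tb]; first by have := subgroupM sT Ta Tab; rewrite mulVKg.
by have := subgroupM sT Tb (subgroupV sT Tab); rewrite invgM invgK mulVKg.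
Qed.

Lemma expgV_comm t m n : t ^- m * t ^+ n = t ^+ n * t ^- m.
Proof. by have := commuteV (commuteX2 n m (commute_refl t)); rewrite /commute => ->. Qed.

Lemma powers_subgroup t : subgroup (powers t).
Proof.
have mix m n : powers t (t ^+ m * t ^- n).
  have [le|/ltnW le] := leqP n m.
    by left; exists (m - n)%N => //; rewrite expgnFr.
  by right; exists (n - m)%N => //; rewrite expgnFr// invgM invgK.
split; first by left; exists 0%N.
move=> _ _ [[m _ <-]|[m _ <-]] [[n _ <-]|[n _ <-]].
- exact: mix.
- by left; exists (m + n)%N => //; rewrite invgK expgnDr.
- by right; exists (n + m)%N => //; rewrite expgnDr invgM.
- by rewrite invgK expgV_comm; exact: mix.
Qed.

Lemma powers_sub S t : subgroup S -> S t -> powers t `<=` S.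
Proof.
move=> sS St _ [[n _ <-]|[n _ <-]]; first exact: subgroupX.
by apply: subgroupV => //; exact: subgroupX.
Qed.

Definition cyclic_extension t T : set G :=
  [set x | exists2 y, powers t y & T (y^-1 * x)].

Lemma cyclic_extension_subgroup S T t : normal_in T S -> subgroup S -> S t ->
  subgroup (cyclic_extension t T).
Proof.
move=> nT sS St; have [sT TS cT] := nT; have sp := powers_subgroup t.
split=> [|x x' [y py Ty] [y' py' Ty']].
  by exists 1; [case: sp|rewrite mulg1 invg1; case: sT].
exists (y / y'); first exact: sp.2.
have Sy' : S y' := powers_sub sS St py'.
apply: (coset_congM nT) => //; first exact: subgroupV.
rewrite invgK; apply: (coset_congV nT sS _ Ty').
by have := subgroupM sS Sy' (TS _ Ty'); rewrite mulVKg.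
Qed.

Lemma cyclic_extension_sub S T t : subgroup S -> T `<=` S -> S t ->
  cyclic_extension t T `<=` S.
Proof.
move=> sS TS St x [y /(powers_sub sS St) Sy /TS Syx].
by have := subgroupM sS Sy Syx; rewrite mulVKg.
Qed.

Lemma sub_cyclic_extension T t : T `<=` cyclic_extension t T.
Proof.
by move=> x Tx; exists 1; [left; exists 0%N|rewrite invg1 mul1g].
Qed.

Lemma mem_cyclic_extension T t : subgroup T -> cyclic_extension t T t.
Proof.
by move=> [T1 _]; exists t; [left; exists 1%N|rewrite mulVg].
Qed.

End Congruence.

Section Polycyclic.

Inductive polycyclic (G : groupType) : set G -> Prop :=
| polycyclic1 : polycyclic [set 1]
| polycyclic_ext S T t of polycyclic T & subgroup S & normal_in T S & S t &
    S `<=` cyclic_extension t T : polycyclic S.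

Lemma polycyclic_subgroup (G : groupType) (S : set G) : polycyclic S -> subgroup S.
Proof.
by case=> //; split=> // x y -> ->; rewrite /= mulgV.
Qed.

(** A subgroup of a polycyclic group is polycyclic: the exponents of the top generator that
    occur in the subgroup form a subgroup of the integers, hence are the multiples of a least one.
    The subgroup is given by an injection so that the result applies to an abstract group. *)
Lemma polycyclic_preimage (K H : groupType) (f : group_hom K H) (S : set H) :
  injective f -> polycyclic S -> polycyclic (f @^-1` S).
Proof.
move=> fI; elim=> [|{}S T t pT IH sS nT St ST].
  suff -> : f @^-1` [set 1] = [set 1] by exact: polycyclic1.
  apply/seteqP; split=> [x /= fx|x ->]; last by rewrite /preimage /= gmulf1.
  by apply: fI; rewrite gmulf1.
have [sT TS cT] := nT.
have sSf : subgroup (f @^-1` S).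
  by split=> [|x y Sx Sy]; rewrite /preimage /= ?gmulf1 ?gmulfF; [case: sS|exact: sS.2].
have nTf : normal_in (f @^-1` T) (f @^-1` S).
  split=> [|x|x y Sx Ty]; [|exact: TS|by rewrite /preimage /= gmulfJ; exact: cT].
  by split=> [|x y Sx Sy]; rewrite /preimage /= ?gmulf1 ?gmulfF; [case: sT|exact: sT.2].
have [sTf _ cTf] := nTf.
have StX n : S (t ^+ n) by exact: subgroupX.
pose P n := `[< (0 < n)%N /\ exists k, T (t ^- n * f k) >].
(* the exponents of [t] that occur in [f K] form a subgroup of Z *)
have [s Ss gen] : exists2 s, S (f s) & forall n x, S (f x) -> T (t ^- n * f x) ->
    cyclic_extension s (f @^-1` T) x.
  have [[n0 Pn0]|nP] := EM (exists n, P n); last first.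
    exists 1; first by rewrite gmulf1; case: sS.
    move=> [|n] x Sx Tx; last first.
      by case: nP; exists n.+1; apply/asboolP; split=> //; exists x.
    by apply: sub_cyclic_extension; move: Tx; rewrite expg0 invg1 mul1g.
  have ex : exists n, P n by exists n0.
  case: (ex_minnP ex) => m /asboolP[m_gt0 [s Ts]] mmin {n0 Pn0 ex}.
  have Ss : S (f s) by have := subgroupM sS (StX m) (TS _ Ts); rewrite mulVKg.
  exists s => // n x Sx Tx; exists (s ^+ (n %/ m)); first by left; exists (n %/ m).
  have Tr : T (t ^- (n %% m) * f (s ^- (n %/ m) * x)).
    have := coset_congX (n %/ m) nT sS (StX m) Ts => Tq.
    have := coset_congV nT sS _ Tq.
    move=> /(_ (subgroupX _ sS Ss)) => Tq'.
    rewrite -expgnA in Tq'.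
    have := @coset_congM _ T S (t ^+ (m * (n %/ m)))^-1 (f s ^+ (n %/ m))^-1 (t ^+ n) (f x) nT (StX n).
    rewrite invgK => /(_ Tq' Tx).
    have -> : t ^- (m * (n %/ m)) * t ^+ n = t ^+ (n %% m).
      by rewrite {2}(divn_eq n m) [(n %/ m * m)%N]mulnC expgnDr mulKg.
    by rewrite gmulfM gmulfV gmulfXn.
  have [r0|r_gt0] := posnP (n %% m).
    by move: Tr; rewrite r0 expg0 invg1 mul1g /preimage /=.
  have /mmin : P (n %% m) by apply/asboolP; split=> //; eexists; exact: Tr.
  by rewrite leqNgt ltn_mod m_gt0.
apply: (polycyclic_ext IH sSf nTf Ss) => x Sx.
have [_ [[n _ <-]|[n _ <-]] Tx] := ST _ Sx; first exact: gen Tx.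
have sC := cyclic_extension_subgroup nTf sSf Ss.
rewrite -(invgK x); apply: (subgroupV sC); apply: (gen n).
  by rewrite gmulfV; exact: subgroupV.
rewrite gmulfV; have := coset_congV nT sS Sx Tx; exact.
Qed.

Lemma polycyclic_finite_index (G : groupType) (S N : set G) :
  polycyclic S -> normal_in N setT ->
  (forall x, S x -> exists2 m, (0 < m)%N & N (x ^+ m)) -> finite_index S N.
Proof.
move=> pS nN; have [sN _ cN] := nN.
elim: pS => [_|{}S T t pT IH sS nT St ST tor].
  by exists [:: 1] => _ ->; exists 1; rewrite ?inE// mulg1 invg1; case: sN.
have [sT TS _] := nT.
have [s sP] := IH (fun x Tx => tor x (TS x Tx)).
have [m m_gt0 Nm] := tor t St.
have red n : exists2 i, i \in iota 0 m & N ((t ^+ i)^-1 * t ^+ n).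
  exists (n %% m); first by rewrite mem_iota ltn_mod.
  rewrite {2}(divn_eq n m) addnC expgnDr mulKg mulnC expgnA; exact: subgroupX.
exists [seq t ^+ i * g | i <- iota 0 m, g <- s] => x Sx.
have [y py Ty] := ST x Sx; have [g gs Ng] := sP _ Ty.
have [i im Ni] : exists2 i, i \in iota 0 m & N ((t ^+ i)^-1 * y).
  case: py => -[n _ <-]; first exact: red.
  have [i im Ni] := red (m.-1 * n)%N; exists i => //.
  have -> : t ^- n = t ^+ (m.-1 * n) * (t ^+ m) ^- n.
    by rewrite -expgnA -{2}(prednK m_gt0) mulSn addnC expgnDr invgM mulgA -expgV_comm mulgK.
  by rewrite mulgA; apply: subgroupM => //; apply: subgroupV => //; exact: subgroupX.
exists (t ^+ i * g); first exact: allpairs_f.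
by have := coset_congM nN I Ni Ng; rewrite mulVKg.
Qed.

Fixpoint cyclic_product (G : groupType) (s : seq G) : set G :=
  if s is g :: s' then cyclic_extension g (cyclic_product s') else [set 1].

Lemma polycyclic_product (G : groupType) (S : set G) :
  polycyclic S -> exists s, S `<=` cyclic_product s.
Proof.
elim=> [|{}S T t _ [s Ts] _ _ _ ST]; first by exists [::].
by exists (t :: s) => x /ST[y py /Ts Ty]; exists y.
Qed.

End Polycyclic.

(** * The lower central series *)

Section GeneratedBy.
Variable G : groupType.
Implicit Types (A S : set G).

Lemma generated_subgroup A : subgroup (generated A).
Proof.
split=> [S [[S1 _] _]//|x y gx gy S [sS AS]].
by apply: sS.2; [exact: gx|exact: gy].
Qed.

Lemma sub_generated A : A `<=` generated A.
Proof. by move=> x Ax S [_ AS]; exact: AS. Qed.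

Lemma generated_min A S : subgroup S -> A `<=` S -> generated A `<=` S.
Proof. by move=> sS AS x gx; apply: (gx S). Qed.

Lemma commMg (x y z : G) : [~ x * y, z] = [~ x, z] ^ y * [~ y, z].
Proof. by rewrite /commg !conjgE !invgM !mulgA !mulgK ?mulgVK. Qed.

Lemma commgM (x y z : G) : [~ x, y * z] = [~ x, z] * [~ x, y] ^ z.
Proof. by rewrite /commg !conjgE !invgM !mulgA !mulgK ?mulgVK. Qed.

Lemma commVg (x y : G) : [~ x^-1, y] = ([~ x, y] ^ x^-1)^-1.
Proof. by rewrite /commg !conjgE !invgM !invgK !mulgA ?(mulgV, mul1g, mulgK, mulgVK). Qed.

Lemma commgV (x y : G) : [~ x, y^-1] = ([~ x, y] ^ y^-1)^-1.
Proof. by rewrite /commg !conjgE !invgM !invgK !mulgA ?(mulgV, mul1g, mulgK, mulgVK). Qed.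

Lemma conj_comm (x y : G) : x ^ y = x * [~ x, y].
Proof. by rewrite commgEl mulVKg. Qed.

End GeneratedBy.

Section LowerCentral.
Variable G : groupType.
Local Notation gamma := (@lower_central G).

Lemma lower_central_normal n : normal_in (gamma n) setT.
Proof.
elim: n => [//|n [sn _ cn]]; split=> //=; first exact: generated_subgroup.
move=> x y _; apply: (@generated_min _ _ [set y | gamma n.+1 (y ^ x)]).
  have sS := generated_subgroup [set [~ x, y] | x in gamma n & y in [set: G]].
  split=> [|a b ga gb]; first by rewrite /= conj1g; case: sS.
  by rewrite /= conjMg conjVg; exact: sS.2.
move=> _ [a ga [b _ <-]] /=; rewrite conjRg; apply: sub_generated.
by exists (a ^ x); [exact: cn|exists (b ^ x)].
Qed.

Lemma lower_central_comm n x y : gamma n x -> gamma n.+1 [~ x, y].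
Proof. by move=> gx; apply: sub_generated; exists x => //; exists y. Qed.

Lemma lower_central_decr n : gamma n.+1 `<=` gamma n.
Proof.
have [sn _ cn] := lower_central_normal n; apply: generated_min => // _ [a ga [b _ <-]].
by rewrite commgEl; apply: subgroupM => //; [exact: subgroupV|exact: cn].
Qed.

(** [S / gamma n.+1] is central in [G / gamma n.+1]. *)
Lemma between_lower_central_normal n S : subgroup S -> gamma n.+1 `<=` S ->
  S `<=` gamma n -> normal_in S setT.
Proof.
move=> sS gS Sg; split=> // x y _ Sy; rewrite conj_comm.
apply: subgroupM => //; by apply: gS; apply: lower_central_comm; exact: Sg.
Qed.

Hypothesis fgG : finitely_generated G.

(** The commutator induces a bilinear map from the product of [gamma n / gamma n.+1]
    and [G] to [gamma n.+1 / gamma n.+2]: commutators of generators suffice. *)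
Lemma lower_central_fg n : exists s : seq G, [set` s] `<=` gamma n /\
  forall T, subgroup T -> gamma n.+1 `<=` T -> [set` s] `<=` T -> gamma n `<=` T.
Proof.
have [g gP] := fgG.
elim: n => [|n [s [sg sP]]].
  by exists g; split=> // T sT _ gT; rewrite /= -gP; exact: generated_min.
exists [seq [~ x, y] | x <- s, y <- g]; split.
  move=> _ /allpairsP[[x y] /= [xs yg ->]]; apply: lower_central_comm; exact: sg.
move=> T0 sT0 gT0 sgT0.
pose T := T0 `&` gamma n.+1.
have [sn1 _ _] := lower_central_normal n.+1.
have [sn _ _] := lower_central_normal n.
have sT : subgroup T by exact: subgroupI.
have gT : gamma n.+2 `<=` T by move=> x gx; split; [exact: gT0|exact: lower_central_decr].
have [_ _ cT] := between_lower_central_normal sT gT (@subIsetr _ _ _).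
suff gnT : forall x y, gamma n x -> T [~ x, y].
  apply: generated_min => // _ [x gx [y _ <-]]; exact: (gnT x y gx).1.
have genT y : y \in g -> forall x, gamma n x -> T [~ x, y].
  move=> yg; apply: (sP [set x | T [~ x, y]]).
  - split=> [|a b Ta Tb]; first by rewrite /= comm1g; case: sT.
    rewrite /= commMg; apply: subgroupM => //; first exact: cT.
    rewrite commVg.
    by apply: subgroupV => //; exact: cT.
  - by move=> x gx; apply: gT; exact: lower_central_comm.
  - move=> x xs; split; first by apply: sgT0; exact: allpairs_f.
    by apply: lower_central_comm; exact: sg.
move=> x y gx; have : [set: G] y by []; rewrite -gP.
apply: (@generated_min _ _ [set y | T [~ x, y]]); last by move=> z zg; exact: genT.
split=> [|a b Ta Tb]; first by rewrite /= commg1; case: sT.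
rewrite /= commgM; apply: subgroupM => //; last exact: cT.
rewrite commgV.
by apply: subgroupV => //; exact: cT.
Qed.

Lemma nilpotent_polycyclic : nilpotent_group G -> polycyclic [set: G].
Proof.
move=> [c gc]; have : polycyclic (gamma c) by rewrite gc; exact: polycyclic1.
elim: c {gc} => [//|n IH pn]; apply: IH.
have [s [sg sP]] := lower_central_fg n.
have [sn _ _] := lower_central_normal n.
suff [S [pS gS Sg sS]] : exists S, [/\ polycyclic S, gamma n.+1 `<=` S, S `<=` gamma n & [set` s] `<=` S].
  suff <- : S = gamma n by [].
  by apply/seteqP; split=> //; apply: sP => //; exact: polycyclic_subgroup.
elim: s sg {sP} => [|t s IH] sg.
  by exists (gamma n.+1); split=> //; exact: lower_central_decr.
have [|S [pS gS Sg sS]] := IH; first by move=> x xs; apply: sg; exact: mem_behead.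
have [sSS _ nS] := between_lower_central_normal (polycyclic_subgroup pS) gS Sg.
have tg : gamma n t by apply: sg; exact: mem_head.
have sE := cyclic_extension_subgroup (And3 sSS (@subsetT _ _) nS) (@subgroupT G) (I : setT t).
exists (cyclic_extension t S); split.
- apply: (polycyclic_ext pS sE _ (mem_cyclic_extension t sSS)) => //.
  by split=> // [|x y _]; [exact: sub_cyclic_extension|exact: nS].
- by move=> x /gS; exact: sub_cyclic_extension.
- exact: cyclic_extension_sub.
- move=> x; rewrite /= inE => /orP[/eqP->|/sS]; first exact: mem_cyclic_extension.
  exact: sub_cyclic_extension.
Qed.

End LowerCentral.

(** * The pro-p topology of nilpotent groups *)

Section NilpotentEmbedded.
Variables (p : nat) (pr_p : prime p) (H : groupType).
Hypotheses (fgH : finitely_generated H) (nilH : nilpotent_group H).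
Variables (K U : set H).
Hypotheses (sK : subgroup K) (nU : normal_in U K) (pU : p_power_index p K U).

Let sU : subgroup U. Proof. by case: nU. Qed.
Let UK : U `<=` K. Proof. by case: nU. Qed.

Let torU x : K x -> exists e, U (x ^+ (p ^ e)).
Proof. by have [_ t] := (p_power_indexP pr_p sK nU).1 pU; exact: t. Qed.

Lemma coprime_power_mem (a b : nat) x : (0 < a)%N -> coprime a b ->
  U (x ^+ a) -> U (x ^+ b) -> U x.
Proof.
move=> a_gt0 cab Ua Ub; have [u _ /dvdnP[v e]] := Bezoutl b a_gt0.
move: e; rewrite (eqP cab) => e.
have : U (x ^+ (1 + u * b)) by rewrite e mulnC expgnA; exact: subgroupX.
rewrite expgnDr expg1 mulnC expgnA => Uxb.
have := subgroupM sU Uxb (subgroupV sU (subgroupX u sU Ub)).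
by rewrite mulgK.
Qed.

(** By Zorn's lemma.  In the quotient by such a maximal [N], every nontrivial normal subgroup
    meets the image of [K] outside that of [U]. *)
Lemma maximal_normal_avoiding : exists N, [/\ normal_in N setT, N `&` K `<=` U &
  forall M, normal_in M setT -> N `<=` M -> M `&` K `<=` U -> M `<=` N].
Proof.
(* the empty set is admitted as an upper bound of the empty chain *)
pose P (N : set H) := N = set0 \/ (normal_in N setT /\ N `&` K `<=` U).
have [F FP tF|N [PN maxN]] := @Zorn_bigcup _ P.
  have [[A0 [FA0 A0n0]]|nF] := EM (exists A, F A /\ A <> set0); last first.
    left; apply/seteqP; split=> // x [A FA Ax]; apply: nF; exists A; split=> // e.
    by rewrite e in Ax.
  right.
  have good A : F A -> A <> set0 -> normal_in A setT /\ A `&` K `<=` U.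
    by move=> /FP[].
  have ne (A : set H) x : A x -> A <> set0 by move=> Ax e; rewrite e in Ax.
  split; last by move=> x [[A FA Ax] Kx]; apply: (good A FA (ne _ _ Ax)).2.
  split=> //; first split.
  - by exists A0 => //; have [[[]]] := good A0 FA0 A0n0.
  - move=> x y [A FA Ax] [B FB By].
    have [AB|BA] := tF A B FA FB.
      exists B => //; have [[sB _ _] _] := good B FB (ne _ _ By).
      by apply: sB.2 => //; exact: AB.
    exists A => //; have [[sA _ _] _] := good A FA (ne _ _ Ax).
    by apply: sA.2 => //; exact: BA.
  - move=> x y _ [A FA Ay]; exists A => //.
    by have [[_ _ cA] _] := good A FA (ne _ _ Ay); exact: cA.
have P1 : P [set 1].
  right; split; last by move=> _ [-> _]; case: sU.
  split=> // [|x _ _ ->]; last by rewrite /= conj1g.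
  by split=> // x y -> ->; rewrite /= mulgV.
have maxN' M : P M -> N `<=` M -> M `<=` N.
  move=> PM NM; apply: contrapT => nMN; exact: (maxN M).
case: PN => [N0|[nN NU]].
  by have := maxN' _ P1; rewrite N0 => /(_ (@sub0set _ _) 1 erefl).
by exists N; split=> // M nM NM MU; apply: maxN' => //; right.
Qed.

Section RelativeUpperCentral.
Variable N : set H.
Hypotheses (nN : normal_in N setT) (NU : N `&` K `<=` U).
Hypothesis maxN :
  forall M, normal_in M setT -> N `<=` M -> M `&` K `<=` U -> M `<=` N.

(** The upper central series of [H / N], lifted to [H]. *)
Fixpoint upper_central (n : nat) : set H :=
  if n is n'.+1 then [set x | forall g, upper_central n' [~ x, g]] else N.

Lemma upper_central_normal n : normal_in (upper_central n) setT.
Proof.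
elim: n => [//|n [sn _ cn]]; split=> //=.
  split=> [g|x y Zx Zy g]; first by rewrite comm1g; case: sn.
  rewrite commMg commVg; apply: subgroupM => //; first exact: cn.
  by apply: subgroupV => //; exact: cn.
move=> x y _ Zy g /=; rewrite -(conjgKV x g) -conjRg; exact: cn.
Qed.

Lemma upper_central_exhausts : exists c, forall x, upper_central c x.
Proof.
have [c gc] := nilH; exists c.
suff main j : (j <= c)%N -> @lower_central H (c - j) `<=` upper_central j.
  by move=> x; apply: (main c (leqnn c)); rewrite subnn.
elim: j => [_|j IH lt]; first by rewrite subn0 gc => _ ->; case: nN => -[].
move=> x gx g; apply: IH; first exact: ltnW.
by have := lower_central_comm g gx; rewrite -subSn.
Qed.

Lemma cyclic_extension_central y : upper_central 1 y ->
  normal_in (cyclic_extension y N) setT.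
Proof.
have [sN _ cN] := nN => Zy; split=> //; first exact: (cyclic_extension_subgroup nN).
have powC g w : powers y w -> N [~ w, g].
  have [s1 _ _] := upper_central_normal 1.
  by move=> /(powers_sub s1 Zy) Zw; exact: Zw.
move=> g z _ [w pw Nz]; exists w => //.
have -> : z ^ g = w * ([~ w, g] * (w^-1 * z) ^ g).
  by rewrite mulgA -conj_comm -conjMg mulVKg.
by rewrite mulKg; apply: subgroupM => //; [exact: powC|exact: cN].
Qed.

Lemma central_witness y : upper_central 1 y -> ~ N y ->
  exists z, [/\ K z, ~ U z & cyclic_extension y N z].
Proof.
move=> Zy nNy; apply: contrapT => nz; apply: nNy.
have [sN _ _] := nN.
apply: (maxN (cyclic_extension_central Zy)) (mem_cyclic_extension _ sN).
  exact: sub_cyclic_extension.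
by move=> z [Ez Kz]; apply: contrapT => nUz; apply: nz; exists z.
Qed.

(** Let [x] be central modulo [N], with no p-power in [N].  If [x] has finite order modulo [N],
    then its p-power [y] of order prime to [p] generates, modulo [N], a normal subgroup that
    meets [K] only in [U], since [K / U] is a p-group.  If [x] has infinite order, some nonzero power
    [w] of [x] agrees modulo [N] with an element of [K]; raising it to the order of that element
    modulo [U] gives a normal subgroup [<w ^+ (p ^ e)> N] that meets [K] only in [U].  Both
    contradict the maximality of [N]. *)
Lemma upper_central1_torsion x : upper_central 1 x -> exists e, N (x ^+ (p ^ e)).
Proof.
move=> Zx; apply: contrapT => tors; have [sN _ cN] := nN.
have sT := @subgroupT H.
have notN e : ~ N (x ^+ (p ^ e)) by move=> Nx; apply: tors; exists e.
have [s1 _ _] := upper_central_normal 1.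
have [[n [n_gt0 Nn]]|inf] := EM (exists n, (0 < n)%N /\ N (x ^+ n)).
  have [q cpq nq] := pfactor_coprime pr_p n_gt0; pose y := x ^+ (p ^ logn p n).
  have Nyq : N (y ^+ q).
    by rewrite -expgnA mulnC -nq.
  have Zy : upper_central 1 y by exact: (subgroupX _ s1 Zx).
  have [z [Kz nUz [w pw Nz]]] := central_witness Zy (notN _).
  have Nwq : N (w ^+ q).
    by case: pw => -[i _ <-]; rewrite ?expVgn -expgnA mulnC expgnA;
       [|apply: subgroupV => //]; exact: subgroupX.
  have Uzq : U (z ^+ q).
    apply: NU; split; last exact: subgroupX.
    by apply/(coset_cong_mem sN _).1: Nwq; exact: (coset_congX _ nN).
  have [e Ue] := torU Kz.
  apply: nUz; apply: (coprime_power_mem _ _ Ue Uzq).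
    by rewrite expn_gt0 prime_gt0.
  exact: coprimeXl.
have [z [Kz nUz [w pw Nz]]] := central_witness Zx (fun Nx => notN 0%N Nx).
have [e Ue] := torU Kz.
have Zw : upper_central 1 w by exact: (powers_sub s1 Zx).
have w_inf n : (0 < n)%N -> ~ N (w ^+ n).
  have w1 : w <> 1.
    by move=> w1; apply: nUz; apply: NU; split=> //; move: Nz; rewrite w1 invg1 mul1g.
  have xinf i : x ^+ i <> 1 -> (0 < n)%N -> ~ N (x ^+ i ^+ n).
    move=> i1 n_gt0; rewrite -expgnA => Nx; apply: inf; exists (i * n)%N; split=> //.
    by rewrite muln_gt0 n_gt0 andbT lt0n; apply/eqP => i0; rewrite i0 in i1.
  case: pw w1 => -[i _ <-]; first exact: xinf.
  move=> i1 n_gt0 Nx; apply: (@xinf i) => //.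
    by move=> e1; apply: i1; rewrite e1 invg1.
  by rewrite -(invgK (_ ^+ n)); apply: subgroupV => //; rewrite -expVgn.
pose y := w ^+ (p ^ e).
have [||z' [Kz' nUz' [w' pw' Nz']]] := @central_witness y.
- exact: (subgroupX _ s1 Zw).
- by apply: w_inf; rewrite expn_gt0 prime_gt0.
have yz : N (y^-1 * z ^+ (p ^ e)) by exact: (coset_congX _ nN).
have [v [Uv Nv]] : exists v, U v /\ N (w'^-1 * v).
  case: pw' => -[i _ <-].
    exists ((z ^+ (p ^ e)) ^+ i); split; first exact: subgroupX.
    exact: (coset_congX _ nN).
  exists ((z ^+ (p ^ e)) ^- i); split; first by apply: subgroupV => //; exact: subgroupX.
  by rewrite invgK; apply: (coset_congV nN) => //; exact: (coset_congX _ nN).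
apply: nUz'.
have Nvz : N (v^-1 * z').
  have := subgroupM sN (subgroupV sN Nv) Nz'.
  by rewrite invgM invgK -mulgA mulVKg.
have : U (v^-1 * z').
  by apply: NU; split=> //; apply: subgroupM => //; apply: subgroupV => //; exact: UK.
by move=> /(subgroupM sU Uv); rewrite mulVKg.
Qed.

Lemma commXg_cong n x g : upper_central n.+2 x ->
  forall m, upper_central n ([~ x, g] ^- m * [~ x ^+ m, g]).
Proof.
move=> Zx; have [sn _ cn] := upper_central_normal n.
elim=> [|m IH]; first by rewrite !expg0 invg1 mul1g comm1g; case: sn.
rewrite !expgS commMg; apply: (coset_congM (upper_central_normal n)) => //.
by rewrite conj_comm mulKg; exact: Zx.
Qed.

(** Torsion climbs the upper central series: modulo the previous term [x |-> [~ x, g]] is a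
    homomorphism, and an exponent that works for finitely many generators [g] works for all. *)
Lemma upper_central_torsion n x :
  upper_central n.+1 x -> exists e, upper_central n (x ^+ (p ^ e)).
Proof.
elim: n x => [|n IH] x Zx; first exact: upper_central1_torsion.
have [s sP] := fgH.
have [sn _ cn] := upper_central_normal n.
have [e He] : exists e, forall g, g \in s -> upper_central n ([~ x, g] ^+ (p ^ e)).
  elim: (s) => [|g s' [e He]]; first by exists 0%N.
  have [e' He'] := IH _ (Zx g); exists (maxn e e') => h; rewrite inE => /orP[/eqP->|hs].
    exact: p_power_le (leq_maxr _ _) He'.
  exact: p_power_le (leq_maxl _ _) (He h hs).
exists e => g; have : [set: H] g by []; rewrite -sP.
apply: (@generated_min _ _ [set g | upper_central n [~ x ^+ (p ^ e), g]]).
  split=> [|a b Za Zb]; first by rewrite /= commg1; case: sn.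
  rewrite /= commgM; apply: subgroupM => //; last exact: cn.
  by rewrite commgV; apply: subgroupV => //; exact: cn.
move=> h hs /=; apply/(coset_cong_mem sn (commXg_cong h Zx _)); exact: He.
Qed.

Lemma maximal_normal_p_normal : p_normal p N.
Proof.
have [c Hc] := upper_central_exhausts.
have tor x : exists e, N (x ^+ (p ^ e)).
  suff main n : forall x, upper_central n x -> exists e, N (x ^+ (p ^ e)) by exact: main (Hc x).
  elim: n => [y Ny|n IH y /upper_central_torsion[e /IH[e' Ne']]]; first by exists 0%N.
  by exists (e + e')%N; rewrite expnD expgnA.
apply/(p_normalP pr_p); split=> //.
apply: polycyclic_finite_index => // [|x _]; first exact: nilpotent_polycyclic.
by have [e Ne] := tor x; exists (p ^ e)%N => //; rewrite expn_gt0 prime_gt0.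
Qed.

End RelativeUpperCentral.

(** The maximal [N] is open: modulo it the group is polycyclic with all elements of p-power
    order, hence a finite p-group. *)
Lemma nilpotent_separation : exists2 N, p_normal p N & N `&` K `<=` U.
Proof.
have [N [nN NU maxN]] := maximal_normal_avoiding.
by exists N => //; exact: maximal_normal_p_normal.
Qed.

End NilpotentEmbedded.

Lemma nilpotent_p_embedded p (H : groupType) (K : set H) : prime p ->
  finitely_generated H -> nilpotent_group H -> subgroup K -> p_embedded p K.
Proof. by move=> *; move=> ? ? ?; exact: nilpotent_separation. Qed.

(** * Topology of the pro-p completion *)

Section CompletionTopology.
Variables (p : nat) (pr_p : prime p) (G : groupType).
Local Notation Ghat := (pro_p_completion p G).
Local Notation pnormal := (p_normal_subgroup p G).
Implicit Types (x y : Ghat) (N M : pnormal) (g h : G).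

Definition p_normal_pack (N : set G) (pN : p_normal p N) : pnormal := SigSub (mem_set pN).

Lemma component_ex x N : exists g, component x N g.
Proof.
by have [g ->] := componentP x N; exists g; apply: lcoset_refl; exact: subgroup_p_normal.
Qed.

Lemma component_lcoset x N g : component x N g -> component x N = lcoset g (set_val N).
Proof.
by have [h ->] := componentP x N => hg; rewrite (lcoset_eq _ hg)//; exact: subgroup_p_normal.
Qed.

Lemma component_one N g : component (1 : Ghat) N g <-> set_val N g.
Proof. by []. Qed.

Lemma component_mulr x y N g h :
  component x N g -> component y N h -> component (x * y) N (g * h).
Proof. by move=> xg yh; rewrite component_mul; exists g => //; exists h. Qed.

Lemma component_invr x N g : component x N g -> component x^-1 N g^-1.
Proof. by move=> xg; rewrite component_inv; exists g. Qed.

Lemma component_expr x N g n : component x N g -> component (x ^+ n) N (g ^+ n).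
Proof.
move=> xg; elim: n => [|n IH].
  by rewrite !expg0; apply/component_one; case: (subgroup_p_normal N).
by rewrite !expgS; exact: component_mulr.
Qed.

Lemma component_unit g N : component (completion_unit p g) N g.
Proof. by apply: lcoset_refl; exact: subgroup_p_normal. Qed.

Lemma component_eqP x y N g h : component x N g -> component y N h ->
  component x N = component y N <-> set_val N (g^-1 * h).
Proof.
by move=> /component_lcoset-> /component_lcoset->; apply: eq_lcoset; exact: subgroup_p_normal.
Qed.

Lemma component_eq_le x y N M : set_val N `<=` set_val M ->
  component x N = component y N -> component x M = component y M.
Proof.
move=> NM e; have [g xg] := component_ex x N.
have yg : component y N g by rewrite -e.
by rewrite (component_lcoset (component_sub NM xg)) (component_lcoset (component_sub NM yg)).
Qed.

Definition completion_ball x N : set Ghat := [set y | component y N = component x N].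

Definition p_normal_meet N M : pnormal :=
  p_normal_pack (p_normalI pr_p (p_normal_subgroupP N) (p_normal_subgroupP M)).

Lemma p_normal_meetl N M : set_val (p_normal_meet N M) `<=` set_val N.
Proof. exact: subIsetl. Qed.

Lemma p_normal_meetr N M : set_val (p_normal_meet N M) `<=` set_val M.
Proof. exact: subIsetr. Qed.

Definition p_normal_top : pnormal := p_normal_pack (p_normalT pr_p G).

(** Finite intersections of basic neighbourhoods are absorbed by intersecting the normal
    subgroups, so the balls around a point form a base. *)
Lemma nbhs_completionP x (A : set Ghat) :
  nbhs x A <-> exists N, completion_ball x N `<=` A.
Proof.
split=> [nA|[N NA]]; last by apply: filterS NA (near_component x N).
pose F := filter_from [set: pnormal] (completion_ball x).
have FF : Filter F.
  apply: filter_from_filter; first by exists p_normal_top.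
  move=> N M _ _; exists (p_normal_meet N M) => // y xy.
  by split; apply: component_eq_le xy; [exact: p_normal_meetl|exact: p_normal_meetr].
have Fx : (set_val : Ghat -> coset_family p G) @ F --> (set_val x : coset_family p G).
  apply/cvg_sup => N; apply/cvg_image.
    by apply/seteqP; split=> // A' _; exists (fun=> A').
  move=> B Bx; exists [set y : coset_family p G | B (y N)].
    exists N => // y xy; have := nbhs_singleton Bx.
    by move: xy; rewrite /completion_ball /component /= => ->.
  by apply/seteqP; split=> [_ [y By <-]//|C BC]; exists (fun=> C).
move: nA; rewrite nbhsE => -[_ [[B oB <-] Bx] BA].
have [N _ NB] : F (set_val @^-1` B) by apply: Fx; exact: open_nbhs_nbhs.
by exists N => y /NB/BA.
Qed.

Lemma completion_ball_clopen x N : clopen (completion_ball x N).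
Proof.
split; first by rewrite openE => y xy; apply/nbhs_completionP; exists N => z; rewrite /completion_ball /= xy.
rewrite -openC openE => y nxy; apply/nbhs_completionP; exists N => z.
by rewrite /completion_ball /= => ->.
Qed.

Lemma completion_eq x y : (forall N, component x N = component y N) -> x = y.
Proof. by move=> e; apply: component_inj; apply/funext. Qed.

Lemma completion_zero_dimensional : zero_dimensional Ghat.
Proof.
move=> x y /eqP xy; apply: contrapT => nU; apply: xy; apply: completion_eq => N.
apply: contrapT => nxy; apply: nU; exists (completion_ball x N); split=> //.
  exact: completion_ball_clopen.
by move=> e; apply: nxy.
Qed.

Lemma completion_hausdorff : hausdorff_space Ghat.
Proof.
move=> x y xy; apply: completion_eq => N.
have [||z [xz yz]] := xy (completion_ball x N) (completion_ball y N).
- by apply/nbhs_completionP; exists N.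
- by apply/nbhs_completionP; exists N.
by rewrite -xz -yz.
Qed.

Lemma ultra_finite_cover T (I : eqType) (F : set_system T) (s : seq I) (P : I -> set T) :
  UltraFilter F -> F [set y | exists2 i, i \in s & P i y] -> exists2 i, i \in s & F (P i).
Proof.
move=> FU; elim: s => [|i s IH] Fs.
  by have [y [j]] := filter_ex Fs.
have [FP|FnP] := in_ultra_setVsetC (P i) FU; first by exists i; rewrite ?mem_head.
have [|j js FPj] := IH; last by exists j => //; exact: mem_behead.
apply: filterS (filterI FnP Fs) => y [nPi [j]]; rewrite inE => /orP[/eqP->//|js Pj].
by exists j.
Qed.

(** An ultrafilter selects one coset of each open normal subgroup, as there are finitely
    many; these cosets are coherent and define the limit. *)
Lemma completion_compact : compact [set: Ghat].
Proof.
rewrite compact_ultra => F FU _.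
have cF N : exists g, F [set y | component y N g].
  have [_ [s sP] _] := (p_normalP pr_p _).1 (p_normal_subgroupP N).
  have [|g _ Fg] := @ultra_finite_cover _ _ F s (fun g => [set y | component y N g]) FU.
    apply: filterS filterT => y _; have [h yh] := component_ex y N.
    have [g gs Ng] := sP h I; exists g => //=.
    rewrite (component_lcoset yh); apply/mem_lcoset.
    have := subgroupV (subgroup_p_normal N) Ng.
    by rewrite invgM invgK.
  by exists g.
pose c N := projT1 (cid (cF N)).
have cP N : F [set y | component y N (c N)] by rewrite /c; case: cid.
have c1 N : exists g, lcoset (c N) (set_val N) = lcoset g (set_val N) by exists (c N).
have c2 N M : set_val N `<=` set_val M ->
    lcoset (c N) (set_val N) `<=` lcoset (c M) (set_val M).
  move=> NM; have [y [/= yN yM]] := filter_ex (filterI (cP N) (cP M)).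
  rewrite -(component_lcoset yN) -(component_lcoset yM); exact: component_sub.
exists (of_family c1 c2); split=> // A /nbhs_completionP[N NA].
apply: filterS (cP N) => y yN; apply: NA.
by rewrite /completion_ball /= component_of_family (component_lcoset yN).
Qed.

Lemma completion_unit_dense (A : set Ghat) x : nbhs x A -> exists g, A (completion_unit p g).
Proof.
move=> /nbhs_completionP[N NA]; have [g xg] := component_ex x N.
exists g; apply: NA; rewrite /completion_ball /= (component_lcoset xg).
by rewrite (component_lcoset (component_unit g N)).
Qed.

Lemma completion_unitM : {morph @completion_unit p G : g h / g * h}.
Proof.
move=> g h; apply: completion_eq => N.
have gh := component_mulr (component_unit g N) (component_unit h N).
by rewrite (component_lcoset gh) (component_lcoset (component_unit _ N)).
Qed.

Lemma completion_pro_p : pro_p_group p Ghat.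
Proof.
split; [exact: completion_compact|exact: completion_hausdorff| |].
  exact/zero_dimension_totally_disconnected/completion_zero_dimensional.
move=> N oN nN; have [sN _ _] := nN.
have N1 : nbhs (1 : Ghat) N by apply: open_nbhs_nbhs; split=> //; case: sN.
have [M MN] := (nbhs_completionP _ _).1 N1.
have memN x g : component x M g -> set_val M g -> N x.
  move=> xg Mg; apply: MN; apply/(component_eqP (g := g) (h := 1)) => //.
    by apply/component_one; case: (subgroup_p_normal M).
  by rewrite mulg1; apply: subgroupV => //; exact: subgroup_p_normal.
have [_ [s sP] tM] := (p_normalP pr_p _).1 (p_normal_subgroupP M).
apply/(p_power_indexP pr_p subgroupT nN); split=> [|x _].
  exists [seq completion_unit p g | g <- s] => x _.
  have [h xh] := component_ex x M; have [g gs Mg] := sP h I.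
  exists (completion_unit p g); first exact: map_f.
  exact: memN (component_mulr (component_invr (component_unit g M)) xh) Mg.
have [g xg] := component_ex x M; have [e Me] := tM g.
by exists e; exact: memN (component_expr _ xg) Me.
Qed.

End CompletionTopology.

(** * Open normal subgroups of profinite groups *)

Section CompactSpaces.
Variable X : topologicalType.

(** Otherwise the sets [A `&` ~` O] would generate a proper filter, with a cluster point outside [O]
    lying in every [A]. *)
Lemma compact_directed (D : set (set X)) (O : set X) : compact [set: X] ->
  D !=set0 -> (forall A B, D A -> D B -> exists2 C, D C & C `<=` A `&` B) ->
  (forall A, D A -> closed A) -> open O ->
  (forall x, (forall A, D A -> A x) -> O x) -> exists2 A, D A & A `<=` O.
Proof.
move=> cX [A0 DA0] dirD clD oO DO; apply: contrapT => nD.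
pose F := filter_from D (fun A => A `&` ~` O).
have FF : ProperFilter F.
  apply: filter_from_proper; last first.
    move=> A DA; apply: contrapT => e; apply: nD; exists A => // x Ax.
    by apply: contrapT => nOx; apply: e; exists x.
  apply: filter_from_filter; first by exists A0.
  move=> A B DA DB; have [C DC CAB] := dirD A B DA DB.
  by exists C => // x [/CAB[Ax Bx] nOx].
have [x [_ xF]] := cX F FF filterT.
have FD A : D A -> F (A `&` ~` O) by move=> DA; exists A.
have Ox : O x.
  apply: DO => A DA; apply: (clD _ DA) => B /(xF _ _ (FD A DA)).
  by move=> [y [[Ay _] By]]; exists y.
have [y [[_ nOy] Oy]] := xF _ _ (FD A0 DA0) (open_nbhs_nbhs (conj oO Ox)).
exact: nOy.
Qed.

(** In a compact Hausdorff space the intersection [Qx] of the clopen neighbourhoods of a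
    point [x] is connected: disjoint open sets that separate two closed pieces of [Qx]
    already cover a clopen neighbourhood of [x], by compactness. *)
Lemma totally_disconnected_zero_dimensional : compact [set: X] ->
  hausdorff_space X -> totally_disconnected [set: X] -> zero_dimensional X.
Proof.
move=> cX hX tX x y /eqP xy; apply: contrapT => nU; apply: xy.
pose D := [set U : set X | clopen U /\ U x].
pose Qx := [set z | forall U, D U -> U z].
have D0 : D !=set0 by exists setT; split=> //; exact: clopenT.
have DI A B : D A -> D B -> exists2 C, D C & C `<=` A `&` B.
  by move=> [cA Ax] [cB Bx]; exists (A `&` B) => //; split=> //; exact: clopenI.
have Dcl A : D A -> closed A by move=> [[]].
have Qxx : Qx x by move=> U [].
have Qxy : Qx y.
  move=> U [cU Ux]; apply: contrapT => nUy; apply: nU; exists U; split=> //.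
have clQ : closed Qx.
  move=> z zQ U DU; apply: (Dcl U DU) => B /zQ[t [Qt Bt]].
  by exists t; split=> //; exact: Qt.
suff cQ : connected Qx.
  have : connected_component setT x y by exists Qx.
  by rewrite tX// => ->.
move=> B [b Bb] [O oO BO] [C cC BC].
pose B' := Qx `&` ~` O.
have clB : closed B by rewrite BC; exact: closedI.
have clB' : closed B' by apply: closedI => //; exact: open_closedC.
have [U [V [oU oV BU BV UV]]] : exists U V : set X,
    [/\ open U, open V, B `<=` U, B' `<=` V & U `&` V = set0].
  have [|U UB UB'] := compact_normal hX cX clB (_ : set_nbhs B (~` B')).
    apply/set_nbhsP; exists (~` B'); split=> //; first exact: closed_openC.
    by rewrite BO => z [Qz Oz] [_].
  exists (interior U), (~` closure U); split.
  - exact: open_interior.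
  - by apply: closed_openC; exact: closed_closure.
  - by move=> z Bz; have /set_nbhsP[W [oW BW WU]] := UB; apply: filterS WU _; apply: open_nbhs_nbhs; split=> //; exact: BW.
  - by move=> z B'z /UB'.
  - by apply/seteqP; split=> // z [/interior_subset/subset_closure Uz].
have [W [[oW cW] Wx] WUV] : exists2 W, D W & W `<=` U `|` V.
  apply: compact_directed => //; first exact: openU.
  move=> z Qz; have [Oz|nOz] := EM (O z).
    by left; apply: BU; rewrite BO.
  by right; apply: BV.
have disj z : U z -> V z -> False by move=> Uz Vz; have : set0 z by rewrite -UV.
have cWU : clopen (W `&` U).
  split; first exact: openI.
  have -> : W `&` U = W `&` ~` V.
    apply/seteqP; split=> z [Wz]; first by move=> Uz; split=> // /disj; apply.
    by move=> nVz; split=> //; have [] := WUV z Wz.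
  by apply: closedI => //; exact: open_closedC.
have cWV : clopen (W `&` V).
  split; first exact: openI.
  have -> : W `&` V = W `&` ~` U.
    apply/seteqP; split=> z [Wz]; first by move=> Vz; split=> // Uz; exact: disj Uz Vz.
    by move=> nVz; split=> //; have [] := WUV z Wz.
  by apply: closedI => //; exact: open_closedC.
have [Ux|Vx] := WUV x Wx.
  apply/seteqP; split=> [z|z Qz]; first by rewrite BO => -[].
  have [_ Uz] := Qz _ (conj cWU (conj Wx Ux)).
  rewrite BO; split=> //; apply: contrapT => nOz.
  by apply: (disj z) => //; exact: BV.
have : Qx b by move: Bb; rewrite BO => -[].
move=> /(_ _ (conj cWV (conj Wx Vx)))[_ Vb].
by case: (disj b) => //; exact: BU.
Qed.

End CompactSpaces.

Section TopologicalGroups.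
Variable Q : topologicalGroupType.
Implicit Types (x y : Q) (M : set Q).

Lemma mulg_cvg T (F : set_system T) (f g : T -> Q) x y : Filter F ->
  f @ F --> x -> g @ F --> y -> (fun z => f z * g z) @ F --> x * y.
Proof.
move=> FF fx gy; apply: (@continuous2_cvg _ _ _ _ F _ f g (fun a b : Q => a * b) x y) => //.
exact: (mulg_continuous (x, y)).
Qed.

Lemma translate_nbhs x y (A : set Q) : nbhs (x * y) A -> nbhs y [set z | A (x * z)].
Proof.
have := @mulg_cvg _ (nbhs y) (fun=> x) id x y _ (cvg_cst x) (@cvg_id _ _); exact.
Qed.

Lemma subgroup_open M : subgroup M -> nbhs (1 : Q) M -> open M.
Proof.
move=> sM M1; rewrite openE => x Mx; rewrite /interior.
have := @translate_nbhs x^-1 x M; rewrite mulVg => /(_ M1).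
apply: filterS => y /= Mxy; have := subgroupM sM Mx Mxy.
by rewrite mulVKg.
Qed.

Lemma lcoset_nbhs x M : open M -> subgroup M -> nbhs x (lcoset x M).
Proof.
move=> oM [M1 _]; have : nbhs (x^-1 * x) M by rewrite mulVg; apply: open_nbhs_nbhs.
by move=> /translate_nbhs; apply: filterS => y /mem_lcoset.
Qed.

(** Inside a clopen neighbourhood [C] of [1], the elements [n] whose insertion anywhere in a
    product never changes membership in [C] form a normal subgroup; it is a neighbourhood
    of [1] because the pairs [(x, y)] around the insertion point range over a compact
    space. *)
Lemma open_normal_base (A : set Q) : compact [set: Q] -> hausdorff_space Q ->
  totally_disconnected [set: Q] -> nbhs (1 : Q) A ->
  exists M, [/\ open M, normal_in M setT & M `<=` A].
Proof.
move=> cQ hQ tQ A1.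
have zQ := totally_disconnected_zero_dimensional cQ hQ tQ.
have [C [C1 [oC cC]] CA] := zero_dimensional_cvg hQ zQ cQ A1.
pose N := [set n : Q | forall x y, C (x * n * y) <-> C (x * y)].
have sN : subgroup N.
  split=> [x y|m n Nm Nn x y]; first by rewrite mulg1.
  rewrite mulgA -(mulgA (x * m)) Nm mulgA.
  by have := Nn (x * n^-1) y; rewrite mulgVK => ->.
have nN : normal_in N setT.
  split=> // m n _ Nn x y; rewrite conjgE !mulgA.
  by have := Nn (x * m^-1) (m * y); rewrite !mulgA mulgVK.
exists N; split=> //; last first.
  by move=> n Nn; apply: CA; have := Nn 1 1; rewrite !mul1g !mulg1 => -[_]; apply.
apply: subgroup_open => //.
have near z : nbhs z [set z' | C z' <-> C z].
  have [Cz|nCz] := EM (C z).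
    by apply: filterS (open_nbhs_nbhs (conj oC Cz)) => z' Cz'.
  have oC' : open (~` C) by exact: closed_openC.
  by apply: filterS (open_nbhs_nbhs (conj oC' nCz)) => z' Cz'; split.
have cQQ : compact ([set: Q] `*` [set: Q]) by exact: compact_setX.
have /compact_near_coveringP := cQQ.
move=> /(_ Q (nbhs (1 : Q)) (fun n xy => C (xy.1 * n * xy.2) <-> C (xy.1 * xy.2))).
move=> /(_ _ _) H; have : \forall n \near (1 : Q), [set: Q] `*` [set: Q] `<=`
    (fun xy => C (xy.1 * n * xy.2) <-> C (xy.1 * xy.2)).
  apply: H => -[x y] _ /=.
  have c1 : (fun z : (Q * Q) * Q => z.1.1 * z.2 * z.1.2) @ ((x, y), (1 : Q)) --> x * 1 * y.
    apply: mulg_cvg; first apply: mulg_cvg.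
    - exact: (cvg_comp fst fst cvg_fst cvg_fst).
    - exact: cvg_snd.
    - exact: (cvg_comp fst snd cvg_fst cvg_snd).
  have c2 : (fun z : (Q * Q) * Q => z.1.1 * z.1.2) @ ((x, y), (1 : Q)) --> x * y.
    apply: mulg_cvg.
    - exact: (cvg_comp fst fst cvg_fst cvg_fst).
    - exact: (cvg_comp fst snd cvg_fst cvg_snd).
  have N1 : nbhs ((x, y), (1 : Q)) [set z | C (z.1.1 * z.2 * z.1.2) <-> C (x * 1 * y)].
    exact: c1 _ (near _).
  have N2 : nbhs ((x, y), (1 : Q)) [set z | C (z.1.1 * z.1.2) <-> C (x * y)].
    exact: c2 _ (near _).
  apply: filterS (filterI N1 N2) => -[[x' y'] n] /= [-> ->].
  by rewrite mulg1.
by apply: filterS => n Hn x y; exact: (Hn (x, y)).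
Qed.

End TopologicalGroups.

(** * Completions of amalgamated products *)

Section ProPGroups.
Variables (p : nat) (Q : topologicalGroupType) (pQ : pro_p_group p Q).
Implicit Types (x y : Q) (M : set Q).

Lemma pro_p_nbhs x (A : set Q) : nbhs x A ->
  exists M, [/\ open M, normal_in M setT & lcoset x M `<=` A].
Proof.
have [cQ hQ tQ _] := pQ; rewrite -{1}(mulg1 x) => /translate_nbhs.
move=> /(open_normal_base cQ hQ tQ)[M [oM nM MA]].
by exists M; split=> // y /mem_lcoset/MA /=; rewrite mulVKg.
Qed.

Lemma pro_p_separated x y :
  (forall M, open M -> normal_in M setT -> M (x^-1 * y)) -> x = y.
Proof.
have [_ hQ _ _] := pQ; move=> xy; apply: hQ => A B xA yB.
have [M [oM nM MA]] := pro_p_nbhs xA.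
exists y; split; last exact: nbhs_singleton.
by apply: MA; apply/mem_lcoset; exact: xy.
Qed.

End ProPGroups.

Section Density.
Variables (p : nat) (G : groupType) (Q : topologicalGroupType).

Lemma completion_hom_ext (f g : pro_p_completion p G -> Q) : prime p ->
  pro_p_group p Q -> continuous f -> continuous g ->
  (forall a, f (completion_unit p a) = g (completion_unit p a)) -> f =1 g.
Proof.
move=> pr_p pQ cf cg fg x; apply: (pro_p_separated pQ) => M oM nM; have [sM _ _] := nM.
have nf : nbhs x (f @^-1` lcoset (f x) M) by apply: cf; exact: lcoset_nbhs.
have ng : nbhs x (g @^-1` lcoset (g x) M) by apply: cg; exact: lcoset_nbhs.
have [a [/mem_lcoset fa /mem_lcoset ga]] := completion_unit_dense pr_p (filterI nf ng).
rewrite -fg in ga.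
by have := subgroupM sM fa (subgroupV sM ga); rewrite invgM invgK -mulgA mulVKg.
Qed.

End Density.

Section Extension.
Variables (p : nat) (pr_p : prime p) (G : groupType) (Q : topologicalGroupType).
Hypothesis pQ : pro_p_group p Q.
Variable phi : group_hom G Q.
Local Notation Ghat := (pro_p_completion p G).

Definition open_pullback (M : set Q) (oM : open M) (nM : normal_in M setT) :
    p_normal_subgroup p G :=
  p_normal_pack (p_normal_preimage pr_p phi
    (conj nM (let: And4 _ _ _ h := pQ in h M oM nM))).

(** The value at [x] of the extension of [phi]: a point of the intersection, over the open normal
    subgroups [M] of [Q], of the cosets of [M] determined by [x]. *)
Definition extension_value (x : Ghat) (q : Q) :=
  forall M (N : p_normal_subgroup p G) g, open M -> normal_in M setT ->
  set_val N `<=` phi @^-1` M -> component x N g -> M ((phi g)^-1 * q).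

(** The images of the cosets [component x N] form a filter base, which has a cluster point
    by compactness. *)
Lemma extension_value_ex x : exists q, extension_value x q.
Proof.
have [cQ _ _ _] := pQ.
pose F := filter_from [set: p_normal_subgroup p G] (fun N => phi @` component x N).
have FF : ProperFilter F.
  apply: filter_from_proper; last first.
    by move=> N _; have [g xg] := component_ex x N; exists (phi g); exists g.
  apply: filter_from_filter; first by exists (p_normal_top pr_p G).
  move=> N N' _ _; exists (p_normal_meet pr_p N N') => // _ [g xg <-].
  by split; exists g => //; apply: component_sub xg; [exact: p_normal_meetl|exact: p_normal_meetr].
have [q [_ qF]] := cQ F FF filterT.
exists q => M N g oM nM NM xg; have [sM _ _] := nM.
have [|_ [[h xh <-] /mem_lcoset Mq]] := qF (phi @` component x N) (lcoset q M) _ (lcoset_nbhs q oM sM).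
  by exists N.
have : M (phi (g^-1 * h)).
  apply: NM; apply/(component_eqP xg xh).
  by [].
rewrite gmulfM gmulfV => Mgh.
by have := subgroupM sM Mgh (subgroupV sM Mq); rewrite invgM invgK -mulgA mulVKg.
Qed.

Lemma extension_value_uniq x q q' : extension_value x q -> extension_value x q' -> q = q'.
Proof.
move=> xq xq'; apply: (pro_p_separated pQ) => M oM nM; have [sM _ _] := nM.
have [g xg] := component_ex x (open_pullback oM nM).
have Mq := xq M (open_pullback oM nM) g oM nM (fun _ => id) xg; have Mq' := xq' M (open_pullback oM nM) g oM nM (fun _ => id) xg.
by have := subgroupM sM (subgroupV sM Mq) Mq'; rewrite invgM invgK -mulgA mulVKg.
Qed.

(** The universal property of the pro-p completion. *)
Lemma completion_extension : exists f : Ghat -> Q,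
  continuous_hom f /\ forall g, f (completion_unit p g) = phi g.
Proof.
pose f x := projT1 (cid (extension_value_ex x)).
have fP x : extension_value x (f x) by rewrite /f; case: cid.
exists f; split; first split.
- move=> x A /(pro_p_nbhs pQ)[M [oM nM MA]]; have [sM _ _] := nM.
  apply/(nbhs_completionP pr_p); exists (open_pullback oM nM) => y xy.
  have [g xg] := component_ex x (open_pullback oM nM).
  have yg : component y (open_pullback oM nM) g by rewrite xy.
  have Mx := fP x M (open_pullback oM nM) g oM nM (fun _ => id) xg; have My := fP y M (open_pullback oM nM) g oM nM (fun _ => id) yg.
  apply: MA; apply/mem_lcoset.
  by have := subgroupM sM (subgroupV sM Mx) My; rewrite invgM invgK -mulgA mulVKg.
- move=> x y; apply: (extension_value_uniq (fP _)) => M N k oM nM NM xyk.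
  have [sM _ _] := nM.
  have [g xg] := component_ex x N; have [h yh] := component_ex y N.
  have : M (phi (k^-1 * (g * h))).
    by apply: NM; apply/(component_eqP xyk (component_mulr xg yh)).
  rewrite gmulfM gmulfV gmulfM => Mk.
  have Mgh := coset_congM nM I (fP x M N g oM nM NM xg) (fP y M N h oM nM NM yh).
  by have := subgroupM sM Mk Mgh; rewrite -mulgA mulVKg.
move=> g; apply: (extension_value_uniq (fP _)) => M N h oM nM NM xh.
rewrite -gmulfV -gmulfM; apply: NM.
by apply/(component_eqP xh (component_unit g N)).
Qed.

End Extension.

Section CompletionMaps.
Variables (p : nat) (pr_p : prime p) (G H : groupType) (phi : group_hom G H).
Local Notation phihat := (completion_map pr_p phi).

Lemma component_map x M g :
  component x (p_normal_pullback pr_p phi M) g -> component (phihat x) M (phi g).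
Proof.
move=> xg; exists g => //; exists 1; last by rewrite mulg1.
by case: (subgroup_p_normal M).
Qed.

Lemma completion_map_hom : continuous_hom phihat.
Proof.
split.
  apply: completion_continuous => x N.
  apply: filterS (near_component x (p_normal_pullback pr_p phi N)) => y e.
  have [g xg] := component_ex x (p_normal_pullback pr_p phi N).
  have yg : component y (p_normal_pullback pr_p phi N) g by rewrite e.
  by rewrite (component_lcoset (component_map xg)) (component_lcoset (component_map yg)).
move=> x y; apply: completion_eq => N.
have [g xg] := component_ex x (p_normal_pullback pr_p phi N).
have [h yh] := component_ex y (p_normal_pullback pr_p phi N).
have xyN := component_map (component_mulr xg yh).
rewrite (component_lcoset xyN) gmulfM.
by rewrite (component_lcoset (component_mulr (component_map xg) (component_map yh))).
Qed.

Lemma completion_map_inj :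
  (forall U : set G, p_normal p U -> exists2 M : set H, p_normal p M & phi @^-1` M `<=` U) ->
  injective phihat.
Proof.
move=> cof x y e; apply: completion_eq => N.
have [M pM MN] := cof _ (p_normal_subgroupP N).
pose M' := p_normal_pack pM; pose N' := p_normal_pullback pr_p phi M'.
apply: (@component_eq_le _ _ _ _ N'); first exact: MN.
have [g xg] := component_ex x N'; have [h yh] := component_ex y N'.
apply/(component_eqP xg yh).
have := component_map xg; rewrite e => xg'.
have := (component_eqP xg' (component_map yh)).1 erefl.
by rewrite -gmulfV -gmulfM.
Qed.

(** Embeddedness of the image says that the preimages of the open normal subgroups are
    cofinal among those of the source, which is what injectivity on completions requires. *)
Lemma embedded_cofinal : injective phi -> p_embedded p (range phi) ->
  forall U : set G, p_normal p U -> exists2 M : set H, p_normal p M & phi @^-1` M `<=` U.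
Proof.
move=> phiI emb U /(p_normalP pr_p)[nU [s sP] tU]; have [sU _ cU] := nU.
have sR : subgroup (range phi).
  split=> [|_ _ [x _ <-] [y _ <-]]; first by exists 1; rewrite ?gmulf1.
  by exists (x / y); rewrite // gmulfF.
have nR : normal_in (phi @` U) (range phi).
  split=> [|_ [x _ <-]|_ _ [x _ <-] [y Uy <-]]; [|by exists x|].
    split=> [|_ _ [x Ux <-] [y Uy <-]]; first by exists 1; rewrite ?gmulf1//; case: sU.
    by exists (x / y); [exact: sU.2|rewrite gmulfF].
  by exists (y ^ x); [exact: cU|rewrite gmulfJ].
have [|N pN NU] := emb _ nR.
  apply/(p_power_indexP pr_p sR nR); split=> [|_ [x _ <-]].
    exists [seq phi g | g <- s] => _ [x _ <-]; have [g gs Ug] := sP x I.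
    exists (phi g); first exact: map_f.
    by exists (g^-1 * x); rewrite // gmulfM gmulfV.
  by have [e Ue] := tU x; exists e; exists (x ^+ (p ^ e)); rewrite // gmulfXn.
exists N => // x Nx; have [|y Uy /phiI <-//] := NU (phi x).
by split=> //; exists x.
Qed.

End CompletionMaps.

Section CompletedAmalgam.
Variables (p : nat) (pr_p : prime p) (K H1 H2 Gam : groupType).
Variables (k1 : group_hom K H1) (k2 : group_hom K H2).
Variables (h1 : group_hom H1 Gam) (h2 : group_hom H2 Gam).
Hypothesis amalgam : amalgamated_free_product k1 k2 h1 h2.

(** Homomorphisms from the completed factors restrict to the factors, glue on the abstract
    amalgam, and extend to its completion; the required equalities need checking only
    on dense abstract subgroups. *)
Lemma completed_amalgam :
  injective (completion_map pr_p k1) -> injective (completion_map pr_p k2) ->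
  pro_p_amalgam p (completion_map pr_p k1) (completion_map pr_p k2)
    (completion_map pr_p h1) (completion_map pr_p h2).
Proof.
move=> k1I k2I.
have pro (G : groupType) : pro_p_group p (pro_p_completion p G) by exact: completion_pro_p.
have mapC (G H : groupType) (phi : group_hom G H) : continuous (completion_map pr_p phi).
  by have [] := completion_map_hom pr_p phi.
have mapM (G H : groupType) (phi : group_hom G H) :
    {morph completion_map pr_p phi : x y / x * y}.
  by have [] := completion_map_hom pr_p phi.
have compC (X Y Z : topologicalType) (f : Y -> Z) (g : X -> Y) :
    continuous g -> continuous f -> continuous (f \o g).
  by move=> cg cf x; apply: continuous_comp; [exact: cg|exact: cf].
split; try exact: completion_map_hom.
- by split; exact: pro.
- by split; [exact: completion_map_hom|exact: k1I].
- by split; [exact: completion_map_hom|exact: k2I].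
- apply: (completion_hom_ext pr_p (pro Gam)); try by apply: compC; exact: mapC.
  by move=> k /=; rewrite !completion_map_unit; congr completion_unit; exact: (amalg_comm amalgam).
- move=> Q f1 f2 pQ [cf1 f1M] [cf2 f2M] f12.
  have [u1 u1E] : exists u : group_hom H1 Q, forall g, u g = f1 (completion_unit p g).
    apply: (@hom_pack _ _ (fun g => f1 (completion_unit p g))) => x y.
    by rewrite completion_unitM f1M.
  have [u2 u2E] : exists u : group_hom H2 Q, forall g, u g = f2 (completion_unit p g).
    apply: (@hom_pack _ _ (fun g => f2 (completion_unit p g))) => x y.
    by rewrite completion_unitM f2M.
  have [|u [uh1 uh2 uu]] := amalg_univ amalgam (f1 := u1) (f2 := u2).
    move=> k /=; rewrite u1E u2E -!(completion_map_unit pr_p); exact: f12.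
  have [f [[cf fM] fE]] := completion_extension pr_p pQ u.
  exists f; split=> //.
  + apply: (completion_hom_ext pr_p pQ) => //; first by apply: compC => //; exact: mapC.
    by move=> g /=; rewrite completion_map_unit fE -u1E; exact: uh1.
  + apply: (completion_hom_ext pr_p pQ) => //; first by apply: compC => //; exact: mapC.
    by move=> g /=; rewrite completion_map_unit fE -u2E; exact: uh2.
  move=> f' [cf' f'M] e1 e2; apply: (completion_hom_ext pr_p pQ) => // g.
  apply: (amalgam_hom_ext amalgam (f := fun g => f' (completion_unit p g))
    (f' := fun g => f (completion_unit p g))).
  - by move=> x y; rewrite completion_unitM f'M.
  - by move=> x y; rewrite completion_unitM fM.
  - move=> h /=; rewrite fE -(completion_map_unit pr_p); have /= -> := e1 (completion_unit p h).
    by rewrite -u1E; apply/esym; exact: uh1.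
  - move=> h /=; rewrite fE -(completion_map_unit pr_p); have /= -> := e2 (completion_unit p h).
    by rewrite -u2E; apply/esym; exact: uh2.
Qed.

End CompletedAmalgam.

(** * Products of procyclic groups and dihedral extensions *)

Section ClosedProducts.
Variable G : topologicalGroupType.
Implicit Types (s t : seq G) (x y g : G).

(** Products of the closures of cyclic subgroups, in the order of a list; a recursive form of the
    sets that bounded generation asks to cover the group. *)
Fixpoint closed_product s : set G :=
  if s is g :: s' then
    [set x | exists2 y, closure (powers g) y & closed_product s' (y^-1 * x)]
  else [set 1].

Lemma closed_product_cat s t x y :
  closed_product s x -> closed_product t y -> closed_product (s ++ t) (x * y).
Proof.
elim: s x => [x ->|g s IH x [z gz sz] ty]; first by rewrite mul1g.
by exists z => //; rewrite mulgA; exact: IH.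
Qed.

Lemma closed_product_powers x g : powers g x -> closed_product [:: g] x.
Proof. by exists x; [exact: subset_closure|rewrite /= mulVg]. Qed.

Lemma closed_product1 s : closed_product s 1.
Proof.
elim: s => [//|g s IH]; exists 1; last by rewrite invg1 mul1g.
by apply: subset_closure; left; exists 0%N.
Qed.

Lemma closed_product_bounded s : (forall x, closed_product s x) -> boundedly_generated G.
Proof.
move=> sG; exists (size s), (fun i => nth 1 s i) => x.
have : closed_product s x by [].
elim: s x {sG} => [x ->|g s IH x [y gy /IH[z zs zx]]].
  by exists (fun=> 1) => [[]//|]; rewrite big_ord0.
exists (fun i => if unlift ord0 i is Some j then z j else y) => [i|].
  by case: unliftP => [j|] -> //=; exact: zs.
rewrite big_ord_recl unlift_none; under eq_bigr do rewrite liftK.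
by rewrite -zx mulVKg.
Qed.

Lemma closed_product_compact s : compact [set: G] -> compact (closed_product s).
Proof.
move=> cG; elim: s => [|g s IH]; first exact: compact_set1.
have -> : closed_product (g :: s) =
    (fun z : G * G => z.1 * z.2) @` (closure (powers g) `*` closed_product s).
  apply/seteqP; split=> [x [y gy sy]|_ [[y z] [/= gy sz] <-]].
    by exists (y, y^-1 * x); rewrite //= mulVKg.
  by exists y; rewrite // mulKg.
apply: continuous_compact; first exact/continuous_subspaceT/mulg_continuous.
apply: compact_setX => //; apply: subclosed_compact cG _ => //.
exact: closed_closure.
Qed.

End ClosedProducts.

Lemma closed_product_map (G H : topologicalGroupType) (f : G -> H) (s : seq G) x :
  continuous_hom f -> closed_product s x -> closed_product (map f s) (f x).
Proof.
move=> [cf fM]; have f1 : f 1 = 1 by apply: (@mulgI _ (f 1)); rewrite -fM !mulg1.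
have fV y : f y^-1 = (f y)^-1 by apply: (@mulgI _ (f y)); rewrite -fM !mulgV.
have fX y n : f (y ^+ n) = f y ^+ n by elim: n => [//|n IH]; rewrite !expgS fM IH.
elim: s x => [x ->//|g s IH x [y gy /IH sy]]; exists (f y); last by rewrite -fV -fM.
move=> B /cf /gy[z [gz Bz]]; exists (f z); split=> //.
by case: gz => -[n _ <-]; [left|right]; exists n; rewrite ?fV ?fX.
Qed.

(** The set of products is compact, hence closed, and the abstract group is dense. *)
Lemma completion_closed_product p (pr_p : prime p) (G : groupType)
    (s : seq (pro_p_completion p G)) :
  (forall g, closed_product s (completion_unit p g)) -> forall x, closed_product s x.
Proof.
move=> sG x.
have cG := completion_compact pr_p (G := G).
have cl := compact_closed (completion_hausdorff pr_p (G := G)) (closed_product_compact cG (s := s)).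
apply: cl => B /(completion_unit_dense pr_p)[g Bg].
by exists (completion_unit p g).
Qed.

Lemma polycyclic_completion p (pr_p : prime p) (G : groupType) : polycyclic [set: G] ->
  exists s : seq (pro_p_completion p G), forall x, closed_product s x.
Proof.
move=> /polycyclic_product[s sG]; exists (map (@completion_unit p G) s).
apply: completion_closed_product => // g; have : cyclic_product s g by exact: sG.
have [u uE] := hom_pack (@completion_unitM p G).
elim: s {sG} g => [g ->|t s IH g [y ty /IH sy]] /=; first by rewrite -uE gmulf1.
exists (u y); last by move: sy; rewrite -!uE gmulfM gmulfV.
apply: subset_closure; case: ty => -[n _ <-]; [left|right]; exists n => //.
  by rewrite gmulfXn uE.
by rewrite gmulfV gmulfXn uE.
Qed.

Section IndexTwo.
Variables (G : groupType) (A : set G).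
Hypothesis sA : subgroup A.

Lemma index2_complement : has_index setT A 2 ->
  exists a, ~ A a /\ forall x, A x \/ A (a^-1 * x).
Proof.
move=> /card_set_bijP[f [fI finj fsurj]].
pose i := f (lcoset 1 A).
have i2 : (i < 2)%N by apply: fI; exists 1.
have j2 : (1 - i < 2)%N by case: (i) i2 => [|[]].
have ij : (1 - i)%N <> i by case: (i) i2 => [|[]].
have [_ [a _ <-] fa] := fsurj _ j2.
have same x y : f (lcoset x A) = f (lcoset y A) -> A (x^-1 * y).
  by move=> e; apply/(eq_lcoset _ _ sA)/finj => //; apply/mem_set; [exists x|exists y].
exists a; split=> [Aa|x].
  by apply: ij; rewrite -fa; congr f; apply/eq_lcoset => //; rewrite mulg1; exact: subgroupV.
have x2 : (f (lcoset x A) < 2)%N by apply: fI; exists x.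
have [e|/eqP ne] := eqVneq (f (lcoset x A)) i.
  by left; have := same 1 x (esym e); rewrite invg1 mul1g.
right; apply: same; rewrite fa; case: (i) (f _) i2 x2 ne => [|[|//]] [|[|//]] //.
Qed.

Lemma complement_index2 a : ~ A a -> (forall x, A x \/ A (a^-1 * x)) -> has_index setT A 2.
Proof.
move=> nAa Aa; have nE : lcoset a A <> lcoset 1 A.
  move=> /(eq_lcoset _ _ sA); rewrite mulg1 => /(subgroupV sA); rewrite invgK; exact: nAa.
apply/card_set_bijP; exists (fun B => if `[< B = lcoset 1 A >] then 0 else 1)%N; split.
- by move=> _ [x _ <-] /=; case: asboolP.
- have cosets x : lcoset x A = lcoset 1 A \/ lcoset x A = lcoset a A.
    have [Ax|Ax] := Aa x; [left|right]; apply/esym/eq_lcoset => //.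
    by rewrite invg1 mul1g.
  move=> _ _ /set_mem/= [x _ <-] /set_mem/= [y _ <-].
  case: asboolP => [->|nx]; case: asboolP => [->|ny] // _.
  by have [//|->] := cosets x; have [//|->] := cosets y.
- move=> [|[|//]] _ /=.
    by exists (lcoset 1 A); [exists 1|case: asboolP].
  by exists (lcoset a A); [exists a|case: asboolP].
Qed.

Lemma index2_normal a : (forall x, A x \/ A (a^-1 * x)) ->
  normal_in A setT /\ (~ A a -> A (a * a)).
Proof.
move=> Aa; split; last first.
  by move=> nAa; have [//|] := Aa (a * a); rewrite mulKg.
split=> // x n _ An; have [Ax|Ax] := Aa x.
  by rewrite conjgE; apply: subgroupM; [|exact: subgroupV|exact: subgroupM].
have [Anx|Anx] := Aa (n * x).
  have Ax' : A x by have := subgroupM sA (subgroupV sA An) Anx; rewrite mulKg.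
  by rewrite conjgE; apply: subgroupM; [|exact: subgroupV|exact: subgroupM].
have := subgroupM sA (subgroupV sA Ax) Anx.
by rewrite invgM invgK -mulgA mulVKg.
Qed.

End IndexTwo.

Lemma mulVKg_cancel (P : groupType) (t x y : P) : (t * x)^-1 * (t * y) = x^-1 * y.
Proof. by rewrite invgM -mulgA mulKg. Qed.

Section Dihedral.
Variables (P : groupType) (N : set P) (a b : P).
Hypotheses (sN : subgroup N) (Naa : N (a * a)) (Nbb : N (b * b)).
Let T := [set x | forall n, N (n ^ x) <-> N n].
Hypotheses (NT : N `<=` T) (Ta : T a) (Tb : T b).

Let sT : subgroup T.
Proof.
split=> [n|x y Tx Ty n]; first by rewrite conjg1.
by rewrite conjgM -(Ty _) conjgKV; exact: Tx.
Qed.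

Let nN : normal_in N T.
Proof. by split=> // x n Tx Nn; exact/(Tx n). Qed.

Let cN x n : T x -> N n -> N (n ^ x). Proof. by case: nN => _ _; exact. Qed.

Let c := a * b.
Let Tc : T c. Proof. exact: (subgroupM sT). Qed.

(** The group generated by [N], [a] and [b], as a union of cosets of [N]: modulo [N] it is
    dihedral, with rotations the powers of [a * b]. *)
Definition dihedral_set : set P :=
  [set x | exists2 w, powers (a * b) w & N (w^-1 * x) \/ N ((w * a)^-1 * x)].

Lemma dihedral_mulN n x : N n -> dihedral_set x -> dihedral_set (n * x).
Proof.
move=> Nn [w pw Nx]; exists w => //.
have Tw : T w by exact: (powers_sub sT Tc).
have aux y : T y -> N (y^-1 * x) -> N (y^-1 * (n * x)).
  move=> Ty Nyx; have := subgroupM sN ((Ty n).2 Nn) Nyx.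
  by rewrite conjgE !mulgA mulgK.
by case: Nx => Nx; [left|right]; apply: aux => //; exact: (subgroupM sT).
Qed.

Lemma dihedral_mulc x : dihedral_set x -> dihedral_set (c * x).
Proof.
move=> [w pw Nx]; exists (c * w).
  by apply: subgroupM => //; [exact: powers_subgroup|left; exists 1%N].
by case: Nx => Nx; [left|right]; rewrite -?(mulgA c) mulVKg_cancel.
Qed.

(** Conjugation by [a] inverts [a * b] modulo [N], as [a] and [b] are involutions there. *)
Lemma dihedral_flip w : powers c w -> exists2 w', powers c w' & N ((w' * a)^-1 * (a * w)).
Proof.
have inv_c : N (c^-1^-1 * c ^ a^-1).
  have : N ((b * b * (a * a) ^ b) ^ a^-1).
    apply: cN; first exact: (subgroupV sT).
    by apply: subgroupM => //; exact: cN.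
  by rewrite /c !conjgE !invgK !mulgA mulgK.
have cX n : N ((c^-1 ^+ n)^-1 * (c ^+ n) ^ a^-1).
  by rewrite conjXg; apply: (coset_congX _ nN sT) => //; exact: (subgroupV sT).
have flip w' v : N (w'^-1 * v ^ a^-1) -> N ((w' * a)^-1 * (a * v)).
  move=> /(cN Ta).
  by rewrite !conjgE !invgK invgM !mulgA mulgVK.
case=> -[n _ <-].
  by exists (c^-1 ^+ n); [right; exists n; rewrite ?expVgn|exact/flip/cX].
exists (c ^+ n); first by left; exists n.
apply: flip; rewrite conjVg.
have Tcn : T ((c ^+ n) ^ a^-1).
  have Ta' := subgroupV sT Ta; have Tcn := subgroupX n sT Tc.
  by rewrite conjgE; exact: (subgroupM sT (subgroupV sT Ta') (subgroupM sT Tcn Ta')).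
have := coset_congV nN sT Tcn (cX n).
by rewrite expVgn.
Qed.

Lemma dihedral_mula x : dihedral_set x -> dihedral_set (a * x).
Proof.
move=> [w pw Nx]; have [w' pw' Nw'] := dihedral_flip pw; exists w' => //.
have comp y z t : N (y^-1 * z) -> N (z^-1 * t) -> N (y^-1 * t).
  by move=> Nyz /(subgroupM sN Nyz); rewrite -mulgA mulVKg.
case: Nx => Nx; [right|left].
  by apply: comp Nw' _; rewrite mulVKg_cancel.
have N1 : N ((a * (w * a))^-1 * (a * x)) by rewrite mulVKg_cancel.
apply: (comp _ _ _ _ N1).
have Na1 : N (a^-1 * a) by rewrite mulVg; case: sN.
have N2 : N ((w' * (a * a))^-1 * (a * (w * a))).
  by have := coset_congM nN Ta Nw' Na1; rewrite !mulgA.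
by apply: (comp _ _ _ _ N2); rewrite mulKg.
Qed.

(** The elements [b], [a^-1] and [b^-1] reduce to [a], [a * b] and [N]. *)
Lemma dihedral_stable t x : N t \/ t = a \/ t = b -> dihedral_set (t * x) <-> dihedral_set x.
Proof.
have aV y : dihedral_set y -> dihedral_set (a^-1 * y).
  move=> /dihedral_mula /(dihedral_mulN (subgroupV sN Naa)).
  by rewrite mulVKg_cancel.
have bE : b = a^-1 * c by rewrite /c mulKg.
have bD y : dihedral_set y -> dihedral_set (b * y).
  by move=> /dihedral_mulc /aV; rewrite bE mulgA.
have bV y : dihedral_set y -> dihedral_set (b^-1 * y).
  move=> /bD /(dihedral_mulN (subgroupV sN Nbb)).
  by rewrite mulVKg_cancel.
case=> [Nt|[->|->]]; split.
- by move=> /(dihedral_mulN (subgroupV sN Nt)); rewrite mulKg.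
- exact: dihedral_mulN.
- by move=> /aV; rewrite mulKg.
- exact: dihedral_mula.
- by move=> /bV; rewrite mulKg.
- exact: bD.
Qed.

Lemma dihedral_factor x : dihedral_set x ->
  exists n w e, [/\ N n, powers (a * b) w, e = 1 \/ e = a & x = n * (w * e)].
Proof.
move=> [w pw Nx].
have Tw : T w by exact: (powers_sub sT Tc).
have aux e : T e -> N ((w * e)^-1 * x) -> exists2 n, N n & x = n * (w * e).
  move=> Te Nxe; exists (((w * e)^-1 * x) ^ (w * e)^-1).
    by apply: cN => //; apply: (subgroupV sT) => //; exact: (subgroupM sT).
  by rewrite -conjgCV mulVKg.
case: Nx => Nx.
  by have [||n Nn ->] := aux 1; [case: sT|rewrite mulg1|exists n, w, 1; split=> //; left].
by have [||n Nn ->] := aux a; [| |exists n, w, a; split=> //; right].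
Qed.

End Dihedral.

(** * Images in finite quotients *)

Section Images.

Lemma image_group_set (G : groupType) (Q : finGroupType) (f : group_hom G Q) :
  group_set [set z : Q | `[< exists x, f x = z >]]%SET.
Proof.
apply/group_setP; split=> [|z w]; rewrite !inE; first by exists 1; rewrite gmulf1.
by move=> [x xz] [y yw]; exists (x * y); rewrite gmulfM xz yw.
Qed.

Definition image_group (G : groupType) (Q : finGroupType) (f : group_hom G Q) : {group Q} :=
  Group (image_group_set f).

Lemma image_groupP (G : groupType) (Q : finGroupType) (f : group_hom G Q) z :
  reflect (exists x, f x = z) (z \in image_group f).
Proof. by apply: (iffP idP); rewrite /image_group /= !inE. Qed.

Lemma mem_image_group (G : groupType) (Q : finGroupType) (f : group_hom G Q) x :
  f x \in image_group f.
Proof. by apply/image_groupP; exists x. Qed.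

Lemma card_image_group (G : groupType) (Q Q' : finGroupType)
    (f : group_hom G Q) (f' : group_hom G Q') :
  (forall x, f x = 1 <-> f' x = 1) -> #|image_group f| = #|image_group f'|.
Proof.
move=> ff'.
have le (R R' : finGroupType) (g : group_hom G R) (g' : group_hom G R') :
    (forall x, g x = 1 -> g' x = 1) -> (#|image_group g'| <= #|image_group g|)%N.
  move=> gg'; have /choice[s sP] (z : R) : exists x, z \in image_group g -> g x = z.
    by have [/image_groupP[x xz]|nz] := boolP (z \in image_group g); [exists x|exists 1].
  apply: (leq_trans _ (leq_imset_card (fun z => g' (s z)) (image_group g))).
  apply/subset_leq_card/fintype.subsetP.
  move=> _ /image_groupP[x <-]; apply/imsetP; exists (g x); first exact: mem_image_group.
  have e := sP _ (mem_image_group g x); apply: (@mulgI _ (g' (s (g x)))^-1).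
  rewrite mulVg -gmulfV -gmulfM; apply: gg'.
  by rewrite gmulfM gmulfV e mulVg.
by apply/eqP; rewrite eqn_leq !le// => x /ff'.
Qed.

(** A system of representatives for the left cosets, indexed by ordinals so that sums over
    cosets become sums over a finite range. *)
Lemma coset_representatives (Q : finGroupType) (B : {group Q}) :
  exists r : 'I_#|[set: Q]%SET : B| -> Q,
    (forall i j, (r i)^-1 * r j \in B -> i = j) /\ (forall z, exists i, (r i)^-1 * z \in B).
Proof.
rewrite -card_lcosets.
have /choice[r rP] (i : 'I_#|lcosets B [set: Q]%SET|) : exists z, enum_val i = (z *: B)%g.
  by have /lcosetsP[z _ zE] := enum_valP i; exists z.
exists r; split=> [i j rij|z].
  by apply/esym/enum_val_inj; rewrite !rP; apply/lcoset_eqP; rewrite fingroup.mem_lcoset.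
have zB : (z *: B)%g \in lcosets B [set: Q]%SET by apply/lcosetsP; exists z; rewrite ?inE.
exists (enum_rank_in zB (z *: B)%g).
by rewrite -fingroup.mem_lcoset -rP enum_rankK_in// fingroup.lcoset_refl.
Qed.

Lemma p_normal_quotient p (G : groupType) (N : set G) : p_normal p N ->
  exists (Q : finGroupType) (q : group_hom G Q),
    [/\ forall z, exists x, q x = z, forall x, q x = 1 <-> N x & exists k, #|Q| = (p ^ k)%N].
Proof.
move=> [nN [k Nk]]; have [Q [q [qM qS qK cQ]]] := finite_quotient subgroupT nN Nk.
have [|f fE] := @hom_pack _ _ q; first by move=> x y; exact: qM.
exists Q, f; split=> [z|x|]; [|by rewrite fE; exact: qK|by exists k].
by have [x _ <-] := qS z; exists x.
Qed.

End Images.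

(** * Affine actions on group rings *)

Section Shift.
Import GRing.Theory.
Variables (Q : finGroupType) (R : nzRingType).
Local Notation M := {ffun Q -> R}.
Implicit Types (z w : Q) (u v : M).

(** Left multiplication in the group ring of [Q], seen as the ring of functions on [Q]. *)
Definition shift z v : M := [ffun x => v (z^-1 * x)].

Lemma shift_add z u v : shift z (u + v)%R = (shift z u + shift z v)%R.
Proof. by apply/ffunP => x; rewrite !ffunE. Qed.

Lemma shift0 z : shift z 0%R = 0%R.
Proof. by apply/ffunP => x; rewrite !ffunE. Qed.

Lemma shift_opp z u : shift z (- u)%R = (- shift z u)%R.
Proof. by apply/ffunP => x; rewrite !ffunE. Qed.

Lemma shift1 u : shift 1 u = u.
Proof. by apply/ffunP => x; rewrite !ffunE invg1 mul1g. Qed.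

Lemma shift_mul z w u : shift (z * w) u = shift z (shift w u).
Proof. by apply/ffunP => x; rewrite !ffunE invgM mulgA. Qed.

Definition indicator (B : {group Q}) : M := [ffun x => (x \in B)%:R%R].

Lemma shift_indicator (B : {group Q}) z : z \in B -> shift z (indicator B) = indicator B.
Proof. by move=> Bz; apply/ffunP => x; rewrite !ffunE groupMl// groupV. Qed.

End Shift.

Section AffineCocycle.
Import GRing.Theory.
Variables (K H1 H2 Gam : groupType).
Variables (k1 : group_hom K H1) (k2 : group_hom K H2).
Variables (h1 : group_hom H1 Gam) (h2 : group_hom H2 Gam).
Hypothesis amalgam : amalgamated_free_product k1 k2 h1 h2.
Variables (Q : finGroupType) (q : group_hom Gam Q) (R : nzRingType).

(** [Gam] acts on the group ring of its quotient [Q] by affine maps: [H1] acts linearly and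
    [H2] linearly after moving the origin to the indicator function of the image
    of [K], which [K] fixes. The orbit of the origin is the cocycle. *)
Lemma affine_cocycle : let c := indicator R (image_group (q \o h1 \o k1)) in
  exists d : Gam -> {ffun Q -> R},
  [/\ forall x y, d (x * y) = (d x + shift (q x) (d y))%R,
      forall h, d (h1 h) = 0%R &
      forall h, d (h2 h) = (c - shift (q (h2 h)) c)%R].
Proof.
move=> c.
pose a1 h (v : {ffun Q -> R}) := shift (q (h1 h)) v.
pose a2 h (v : {ffun Q -> R}) := (shift (q (h2 h)) (v - c) + c)%R.
have [||k v|a [a_1 aM] [ah1 ah2]] := amalgam_action amalgam (a1 := a1) (a2 := a2).
- by split=> [v|g h v]; rewrite /a1 ?gmulf1 ?shift1// !gmulfM shift_mul.
- split=> [v|g h v]; rewrite /a2 ?gmulf1 ?shift1 ?subrK//.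
  by rewrite !gmulfM shift_mul addrK.
- have kk : h2 (k2 k) = h1 (k1 k) by apply/esym; exact: (amalg_comm amalgam k).
  rewrite /a1 /a2 kk shift_add shift_opp shift_indicator ?subrK//.
  exact: (mem_image_group (q \o h1 \o k1)).
have aE : forall g v, a g v = (shift (q g) v + a g 0)%R.
  apply: (amalgam_generated amalgam (S := [set g | forall v, a g v = (shift (q g) v + a g 0)%R])).
  - split=> [v|x y Sx Sy v].
      by rewrite !a_1 gmulf1 shift1 addr0.
    have aV w : a y^-1%g w = (shift (q y^-1%g) w - shift (q y^-1%g) (a y 0))%R.
      have e : a y (shift (q y^-1%g) (w - a y 0))%R = w.
        by rewrite Sy -shift_mul -gmulfM mulgV gmulf1 shift1 subrK.
      by rewrite -{1}e -aM mulVg a_1 shift_add shift_opp.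
    by rewrite !aM Sx [in RHS]Sx aV (aV 0%R) gmulfM shift_mul shift0 add0r !shift_add addrA.
  - by move=> h v; rewrite !ah1 /a1 shift0 addr0.
  - by move=> h v; rewrite !ah2 /a2 !shift_add shift0 add0r addrA.
exists (fun g => a g 0%R); split.
- by move=> x y; rewrite aM aE addrC.
- by move=> h; rewrite ah1 /a1 shift0.
- by move=> h; rewrite ah2 /a2 sub0r shift_opp addrC.
Qed.

End AffineCocycle.

(** * Counting translations *)

(** The trace of bounded generation of the completion on the abstract group. *)
Definition bounded_p_quotients (p : nat) (G : groupType) (r : nat) :=
  forall N : set G, p_normal p N -> exists a : 'I_r -> G, forall g, exists y : 'I_r -> G,
    (forall i, powers (a i) (y i)) /\ N (g^-1 * \prod_(i < r) y i).

Section Counting.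
Import GRing.Theory.
Variables (K H1 H2 Gam : groupType).
Variables (k1 : group_hom K H1) (h1 : group_hom H1 Gam) (h2 : group_hom H2 Gam).
Variables (Q : finGroupType) (q : group_hom Gam Q) (n : nat).
Hypotheses (qS : forall z, exists x, q x = z) (n_gt1 : (1 < n)%N).
Local Notation R := 'Z_n.
Local Notation M := {ffun Q -> R^o}.
Local Notation B := (image_group (q \o h1 \o k1)).
Local Notation c := (indicator R^o B).
Variable d : Gam -> M.
Hypotheses (dM : forall x y, d (x * y) = (d x + shift (q x) (d y))%R).
Hypotheses (dh1 : forall h, d (h1 h) = 0%R).
Hypotheses (dh2 : forall h, d (h2 h) = (c - shift (q (h2 h)) c)%R).

Lemma cocycle1 : d 1 = 0%R.
Proof.
have := dM 1 1; rewrite mulg1 gmulf1 shift1 => /(congr1 (fun v => v - d 1)%R).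
by rewrite subrr addrK.
Qed.

Lemma cocycle_kerl x y : q x = 1 -> d (x * y) = (d x + d y)%R.
Proof. by move=> qx; rewrite dM qx shift1. Qed.

Lemma cocycle_conj x y : q x = 1 -> d (x ^ y^-1) = shift (q y) (d x).
Proof.
move=> qx; have qxy : q (x ^ y^-1) = 1 by rewrite gmulfJ qx conj1g.
have := cocycle_kerl y qxy; rewrite -conjgCV dM => /(congr1 (fun v => v - d y)%R).
by rewrite addrK addrC addKr.
Qed.

Lemma cocycle_kerX x k : q x = 1 -> d (x ^+ k) = (d x *+ k)%R.
Proof.
move=> qx; elim: k => [|k IH]; first by rewrite cocycle1.
by rewrite expgS cocycle_kerl// IH mulrS.
Qed.

Lemma cocycle_eq x y : q (x^-1 * y) = 1 /\ d (x^-1 * y) = 0%R <-> q x = q y /\ d x = d y.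
Proof.
split=> [[qxy dxy]|[qxy dxy]].
  rewrite -(mulVKg x y) dM dxy shift0 addr0 gmulfM qxy mulg1; split=> //.
have e : q (x^-1 * y) = 1 by rewrite gmulfM gmulfV qxy mulVg.
split=> //; rewrite dM -dxy -dM mulVg; exact: cocycle1.
Qed.

(** The kernel of [q] acts on the group ring by translations; these are their vectors. *)
Definition translations : {set M} := [set v : M | `[< exists x, q x = 1 /\ d x = v >]]%SET.

Lemma translationsP v : reflect (exists x, q x = 1 /\ d x = v) (v \in translations).
Proof. by apply: (iffP idP); rewrite /translations !inE. Qed.

Lemma translations0 : 0%R \in translations.
Proof. by apply/translationsP; exists 1; rewrite gmulf1 cocycle1. Qed.

Lemma translations_add u v : u \in translations -> v \in translations ->
  (u + v)%R \in translations.
Proof.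
move=> /translationsP[x [qx <-]] /translationsP[y [qy <-]]; apply/translationsP.
by exists (x * y); rewrite gmulfM qx qy mulg1 cocycle_kerl.
Qed.

Lemma translations_shift u z : u \in translations -> shift z u \in translations.
Proof.
move=> /translationsP[x [qx <-]]; have [y <-] := qS z; apply/translationsP.
by exists (x ^ y^-1); rewrite gmulfJ qx conj1g cocycle_conj.
Qed.

(** The affine action whose linear part is [shift] and whose translation part is [d]. *)
Definition affine (g : Gam) (v : M) : M := (shift (q g) v + d g)%R.

(** The elements [g'] and [g * h x], for a suitable [x], differ by an element of the kernel of [q], which
    acts as a translation, and [h x] fixes [v]. *)
Lemma affine_orbit (H : groupType) (h : group_hom H Gam) v g g' :
  (forall x, affine (h x) v = v) -> (q g)^-1 * q g' \in image_group (q \o h) ->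
  exists2 i, i \in translations & affine g' v = (affine g v + i)%R.
Proof.
move=> hv /image_groupP[x /= qx].
have [y [qy ->]] : exists y, q y = 1 /\ g' = g * (y * h x).
  exists (g^-1 * g' * (h x)^-1); rewrite mulgVK mulVKg; split=> //.
  by rewrite !gmulfM !gmulfV qx mulgV.
exists (shift (q g) (d y)).
  by apply: translations_shift; apply/translationsP; exists y.
rewrite {1}/affine !dM !gmulfM !qy mul1g shift1 shift_mul.
have -> : d (h x) = (v - shift (q (h x)) v)%R by rewrite -{1}(hv x) /affine addrC addKr.
rewrite !shift_add shift_opp /affine addrC -!addrA addNr addr0.
by rewrite addrA addrC.
Qed.

(** The translate of [c] by [q g] is [affine g c - affine g 0].  Here [H2] fixes [c] and [H1] fixes [0],
    so modulo translations there are at most as many of the points [affine g c] as cosets of [H2], and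
    as many of the points [affine g 0] as cosets of [H1].  The span of representatives of these
    points, together with the translations, contains all functions that are constant on the left
    cosets of the image of [K], a free module whose rank is the number of these cosets. *)
Lemma translations_bound :
  (n ^ #|[set: Q]%SET : B| <= #|translations| *
    n ^ (#|[set: Q]%SET : image_group (q \o h1)| + #|[set: Q]%SET : image_group (q \o h2)|))%N.
Proof.
have /choice[s sP] := qS.
have [rB [rBinj _]] := coset_representatives B.
have [r1 [_ r1P]] := coset_representatives (image_group (q \o h1)).
have [r2 [_ r2P]] := coset_representatives (image_group (q \o h2)).
set e1 := #|_ : image_group (q \o h1)| in r1 r1P *.
set e2 := #|_ : image_group (q \o h2)| in r2 r2P *.
set eB := #|_ : B| in rB rBinj *.
pose theta (t : M * ({ffun 'I_e1 -> R} * {ffun 'I_e2 -> R})) : M :=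
  (t.1 + \sum_j t.2.1 j *: affine (s (r1 j)) 0 + \sum_j t.2.2 j *: affine (s (r2 j)) c)%R.
pose S v := exists t, t.1 \in translations /\ v = theta t.
have S_add u v : S u -> S v -> S (u + v)%R.
  move=> [[i [f g]] [/= Ii ->]] [[i' [f' g']] [/= Ii' ->]].
  exists (i + i', (f + f', g + g'))%R; split; first exact: translations_add.
  rewrite /theta /= addrACA [in LHS](addrACA i) -!big_split /=.
  congr (_ + _ + _)%R; apply: eq_bigr => j _; rewrite ffunE scalerDl //.
have S_trans i : i \in translations -> S i.
  move=> Ii; exists (i, (0, 0))%R; split=> //.
  by rewrite /theta /= !big1 ?addr0// => j _; rewrite ffunE scale0r.
have S_mulrn u k : S u -> S (u *+ k)%R.
  move=> Su; elim: k => [|k IH]; last by rewrite mulrS; exact: S_add.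
  exact: S_trans translations0.
have S_scale u (r : R) : S u -> S (r *: u)%R.
  by move=> Su; rewrite -(natr_Zp r) scaler_nat; exact: S_mulrn.
have S_sum (J : finType) (F : J -> M) : (forall j, S (F j)) -> S (\sum_j F j)%R.
  by move=> SF; apply: big_ind => //; exact: S_trans translations0.
have S_aff0 g : S (affine g 0%R).
  have [j rj] := r1P (q g).
  have [||i Ii ->] := @affine_orbit _ h1 0%R (s (r1 j)) g.
  - by move=> h; rewrite /affine dh1 shift0 addr0.
  - by rewrite sP.
  apply: S_add; last exact: S_trans.
  exists (0, ([ffun k => (k == j)%:R], 0))%R; split; first exact: translations0.
  rewrite /theta /= add0r (bigD1 j)//= !big1 => [|k _|k /negPf kj]; rewrite ?ffunE ?kj ?scale0r//.
  by rewrite eqxx scale1r !addr0.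
have S_affc g : S (affine g c).
  have [j rj] := r2P (q g).
  have [||i Ii ->] := @affine_orbit _ h2 c (s (r2 j)) g.
  - by move=> h; rewrite /affine dh2 addrC subrK.
  - by rewrite sP.
  apply: S_add; last exact: S_trans.
  exists (0, (0, [ffun k => (k == j)%:R]))%R; split; first exact: translations0.
  rewrite /theta /= add0r (bigD1 j)//= !big1 => [|k /negPf kj|k _]; rewrite ?ffunE ?kj ?scale0r//.
  by rewrite eqxx scale1r addr0 add0r.
have S_shift z : S (shift z c).
  have -> : shift z c = (affine (s z) c + (-1 : R)%R *: affine (s z) 0)%R.
    by rewrite /affine sP shift0 add0r scaleN1r addrK.
  by apply: S_add => //; exact: S_scale.
pose psi (F : {ffun 'I_eB -> R}) : M := (\sum_i F i *: shift (rB i) c)%R.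
have psi_inj : injective psi.
  have psiE F j : psi F (rB j) = F j.
    rewrite /psi sum_ffunE (bigD1 j)//= big1 => [|k kj]; rewrite !ffunE.
      by rewrite mulVg group1 addr0; exact: mulr1.
    have [/rBinj kj'|_] := boolP ((rB k)^-1 * rB j \in B).
      by rewrite kj' eqxx in kj.
    exact: mulr0.
  by move=> F F' e; apply/ffunP => j; rewrite -!psiE e.
have /choice[tau tauP] (F : {ffun 'I_eB -> R}) : S (psi F).
  by apply: S_sum => i; exact: S_scale.
have tau_inj : injective tau.
  by move=> F F' e; apply: psi_inj; rewrite (tauP F).2 (tauP F').2 e.

have cR k : #|{ffun 'I_k -> R}| = (n ^ k)%N by rewrite card_ffun !card_ord Zp_cast.
have sub : (tau @: [set: {ffun 'I_eB -> R}]%SET \subset finset.setX translations [set: {ffun 'I_e1 -> R} * {ffun 'I_e2 -> R}]%SET).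
  by apply/fintype.subsetP => _ /imsetP[F _ ->]; rewrite (surjective_pairing (tau F)) finset.in_setX (tauP F).1 finset.in_setT.
have := subset_leq_card sub.
rewrite card_imset// cardsX !cardsT card_prod !cR.
by rewrite expnD.
Qed.
Definition cocycle_kernel : set Gam := [set x | q x = 1 /\ d x = 0%R].

Lemma cocycle_kernel_exponent x : cocycle_kernel (x ^+ (#|Q| * n)).
Proof.
have qx : q (x ^+ #|Q|) = 1.
  by rewrite gmulfXn -cardsT; apply: cyclic.expg_cardG; rewrite finset.in_setT.
split; first by rewrite expgnA gmulfXn qx expg1n.
rewrite expgnA cocycle_kerX//; apply/ffunP => z; rewrite ffunMnE ffunE.
by rewrite -mulr_natr pchar_Zp// mulr0.
Qed.

Lemma cocycle_kernel_normal : normal_in cocycle_kernel setT.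
Proof.
split=> // [|x y _ [qy dy]]; last first.
  split; first by rewrite gmulfJ qy conj1g.
  by rewrite -(invgK x) cocycle_conj// dy shift0.
split=> [|x y kx ky]; first by split; [exact: gmulf1|exact: cocycle1].
have [[qx dx] [qy dy]] := (kx, ky).
have [|e1 e2] := (cocycle_eq y x).2; first by rewrite qx qy dx dy.
have -> : x * y^-1 = (y^-1 * x) ^ y^-1 by rewrite conjgE invgK -mulgA mulVKg.
split; first by rewrite gmulfJ e1 conj1g.
by rewrite cocycle_conj// e2 shift0.
Qed.

Variables (p m k : nat).
Hypotheses (pr_p : prime p) (nE : n = (p ^ m)%N) (cardQ : #|Q| = (p ^ k)%N).

Lemma cocycle_kernel_p_normal : p_normal p cocycle_kernel.
Proof.
apply/(p_normalP pr_p); split=> [||x]; first exact: cocycle_kernel_normal.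
  pose r (z : Q * M) := xget 1 [set x | q x = z.1 /\ d x = z.2].
  exists [seq r z | z : Q * M] => x _; exists (r (q x, d x)); first by apply/fintype.imageP; exists (q x, d x).
  by apply/cocycle_eq; exact: (@xgetI _ _ [set y | q y = q x /\ d y = d x] x).
by exists (k + m)%N; rewrite expnD -cardQ -nE; exact: cocycle_kernel_exponent.
Qed.

(** The quotient by [cocycle_kernel] has exponent dividing [#|Q| * n], so a product of [r] of its
    cyclic subgroups has at most [(#|Q| * n) ^ r] elements. *)
Lemma translations_upper r : bounded_p_quotients p Gam r ->
  (#|translations| <= (#|Q| * n) ^ r)%N.
Proof.
move=> /(_ _ cocycle_kernel_p_normal)[a aP].
have e_gt0 : (0 < #|Q| * n)%N by rewrite muln_gt0 (ltnW n_gt1) cardQ expn_gt0 prime_gt0.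
have [sk _ _] := cocycle_kernel_normal.
pose f (t : {ffun 'I_r -> 'I_(#|Q| * n)}) := d (\prod_(i < r) a i ^+ t i).
rewrite -[(#|Q| * n)%N]card_ord -[X in (_ ^ X)%N]card_ord -card_ffun.
apply: (leq_trans _ (leq_imset_card f predT)).
apply/subset_leq_card/fintype.subsetP => _ /translationsP[x [qx <-]].
have [y [ya xy]] := aP x.
have red i : exists j : 'I_(#|Q| * n), cocycle_kernel ((a i ^+ j)^-1 * y i).
  have ke := cocycle_kernel_exponent (a i).
  have redn l : exists j : 'I_(#|Q| * n), cocycle_kernel ((a i ^+ j)^-1 * a i ^+ l).
    exists (Ordinal (ltn_pmod l e_gt0)) => /=.
    rewrite {2}(divn_eq l (#|Q| * n)) addnC expgnDr mulKg mulnC expgnA; exact: subgroupX.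
  case: (ya i) => -[l _ <-]; first exact: redn.
  have [j kj] := redn ((#|Q| * n).-1 * l)%N; exists j.
  have -> : a i ^- l = a i ^+ ((#|Q| * n).-1 * l) * (a i ^+ (#|Q| * n)) ^- l.
    by rewrite -expgnA -{2}(prednK e_gt0) mulSn addnC expgnDr invgM mulgA -expgV_comm mulgK.
  rewrite mulgA; apply: subgroupM => //; apply: subgroupV => //; exact: subgroupX.
have [j jP] := choice red.
apply/imsetP; exists [ffun i => j i] => //.
have : cocycle_kernel ((\prod_(i < r) a i ^+ j i)^-1 * \prod_(i < r) y i).
  apply: (big_ind2 (fun u v => cocycle_kernel (u^-1 * v))).
  - by rewrite mulg1 invg1; case: sk.
  - move=> u1 v1 u2 v2; exact: (coset_congM cocycle_kernel_normal).
  - by move=> i _; exact: jP.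
move=> /cocycle_eq[_ e]; have [_ ->] := (cocycle_eq _ _).1 xy.
by rewrite -e /f; congr d; apply: eq_bigr => i _; rewrite ffunE.
Qed.

Variables (Q' : finGroupType) (q' : group_hom Gam Q').
Hypotheses (qS' : forall z, exists x, q' x = z).
Hypothesis q'K : forall x, q' x = 1 <-> cocycle_kernel x.

Lemma quotient_eq x y : q' x = q' y <-> q x = q y /\ d x = d y.
Proof.
split=> [e|/cocycle_eq kxy].
  by apply/cocycle_eq; apply: (q'K _).1; rewrite gmulfM gmulfV e mulVg.
have := (q'K (x^-1 * y)).2 kxy; rewrite gmulfM gmulfV.
by move=> /(congr1 (mulg (q' x))); rewrite mulVKg mulg1.
Qed.

(** An element of the quotient by [cocycle_kernel] amounts to its image in [Q] and a translation. *)
Lemma card_quotient : #|Q'| = (#|Q| * #|translations|)%N.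
Proof.
have /choice[s sP] := qS.
have /choice[t tP] (i : M) : exists x, i \in translations -> q x = 1 /\ d x = i.
  by have [/translationsP[x xi]|ni] := boolP (i \in translations); [exists x|exists 1].
pose F (zi : Q * M) := q' (t zi.2 * s zi.1).
have qF z i : i \in translations -> q (t i * s z) = z /\ d (t i * s z) = (i + d (s z))%R.
  by move=> /tP[qt dt]; rewrite gmulfM qt mul1g sP cocycle_kerl// dt.
have Finj : {in finset.setX [set: Q]%SET translations &, injective F}.
  move=> [z i] [w j] /finset.setXP[_ /= Ii] /finset.setXP[_ /= Ij] /quotient_eq[].
  have [-> ->] := qF z i Ii; have [-> ->] := qF w j Ij => <-.
  by move=> /addIr <-.
rewrite -(cardsT Q) -cardsX -(card_in_imset Finj) -cardsT; apply/eq_card => z.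
rewrite finset.in_setT; apply/esym/imsetP; have [x <-] := qS' z.
have qy : q (x * (s (q x))^-1) = 1 by rewrite gmulfM gmulfV sP mulgV.
have Iy : d (x * (s (q x))^-1) \in translations by apply/translationsP; exists (x * (s (q x))^-1).
exists (q x, d (x * (s (q x))^-1)); first by rewrite finset.in_setX finset.in_setT.
apply/quotient_eq; have [-> ->] := qF (q x) _ Iy; split=> //.
by rewrite -cocycle_kerl// mulgVK.
Qed.

Lemma card_image_h1 : #|image_group (q' \o h1)| = #|image_group (q \o h1)|.
Proof.
apply: card_image_group => x /=; rewrite q'K; split=> [[]//|qx]; by split.
Qed.

Lemma card_image_h1k1 : #|image_group (q' \o h1 \o k1)| = #|image_group (q \o h1 \o k1)|.
Proof.
apply: card_image_group => x /=; rewrite q'K; split=> [[]//|qx]; by split.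
Qed.

Lemma card_image_h2 : #|image_group (q' \o h2)| = #|image_group (q \o h2)|.
Proof.
apply: card_image_group => x /=; rewrite q'K; split=> [[]//|qx]; split=> //.
by rewrite dh2 qx shift1 subrr.
Qed.

End Counting.

(** * Indices in finite quotients of boundedly generated amalgams *)

Section EulerCharacteristic.
Variables (K H1 H2 Gam : groupType).
Variables (k1 : group_hom K H1) (k2 : group_hom K H2).
Variables (h1 : group_hom H1 Gam) (h2 : group_hom H2 Gam).
Hypothesis amalgam : amalgamated_free_product k1 k2 h1 h2.
Variables (p r : nat).
Hypotheses (pr_p : prime p) (bounded : bounded_p_quotients p Gam r).

Lemma index_mul (Q Q' : finGroupType) (B : {group Q}) (B' : {group Q'}) t :
  #|B'| = #|B| -> #|Q'| = (#|Q| * t)%N ->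
  #|[set: Q']%SET : B'| = (#|[set: Q]%SET : B| * t)%N.
Proof.
move=> BB QQ; apply/eqP; rewrite -(eqn_pmul2l (cardG_gt0 B')) {2}BB mulnA.
by rewrite !Lagrange ?finset.subsetT// !cardsT QQ.
Qed.

Section Quotient.
Variables (Q : finGroupType) (q : group_hom Gam Q) (k : nat).
Hypotheses (qS : forall z, exists x, q x = z) (cardQ : #|Q| = (p ^ k)%N).
Local Notation E := #|[set: Q]%SET : image_group (q \o h1 \o k1)|.
Local Notation V1 := #|[set: Q]%SET : image_group (q \o h1)|.
Local Notation V2 := #|[set: Q]%SET : image_group (q \o h2)|.

(** Comparing the lower and the upper bound for the number of translations with coefficients
    modulo [n = p ^ m], the exponents of [n] must satisfy the inequality as [m] grows. *)
Lemma index_bound_additive : (E <= V1 + V2 + r)%N.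
Proof.
rewrite leqNgt; apply/negP => lt.
(* beyond [#|Q| ^ r] the powers of [n] dominate the factor coming from [Q] *)
have [m [n [nE m_gt0 lt_n]]] : exists m n, [/\ n = (p ^ m)%N, (0 < m)%N & (#|Q| ^ r < n)%N].
  exists (#|Q| ^ r).+1, (p ^ (#|Q| ^ r).+1)%N; split=> //.
  by apply: ltnW; rewrite ltn_expl// prime_gt1.
have n_gt1 : (1 < n)%N by rewrite nE -(exp1n m) ltn_exp2r// prime_gt1.
have n_gt0 := ltnW n_gt1.
have [d [dM d1 d2]] := affine_cocycle amalgam q ('Z_n)^o.
have low := translations_bound qS n_gt1 dM d1 d2.
have up := translations_upper n_gt1 dM pr_p nE cardQ bounded.
have : (n ^ (V1 + V2 + r).+1 <= (#|Q| * n) ^ r * n ^ (V1 + V2))%N.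
  apply: leq_trans (leq_trans low _); first by rewrite leq_exp2l.
  by rewrite leq_mul2r up orbT.
rewrite expnS expnD expnMn -mulnA [(n ^ r * _)%N]mulnC.
rewrite leq_pmul2r ?muln_gt0 ?expn_gt0 ?n_gt0//.
by rewrite leqNgt lt_n.
Qed.

End Quotient.

(** The cocycle kernel meets [H1], [H2] and the image of [K] in the same subgroups as the kernel
    of [q] does, so replacing [Q] by the quotient by the cocycle kernel multiplies all three
    indices by the number of translations.  If the inequality failed, this number would be at least
    [n], and the defect would exceed [r]. *)
Lemma index_bound (Q : finGroupType) (q : group_hom Gam Q) k :
  (forall z, exists x, q x = z) -> #|Q| = (p ^ k)%N ->
  (#|[set: Q]%SET : image_group (q \o h1 \o k1)| <=
   #|[set: Q]%SET : image_group (q \o h1)| + #|[set: Q]%SET : image_group (q \o h2)|)%N.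
Proof.
move=> qS cardQ; rewrite leqNgt; apply/negP => lt.
set V1 := #|_ : _| in lt; set V2 := #|_ : _| in lt; set E := #|_ : _| in lt.
have [n nE] : exists n, n = (p ^ r.+1)%N by exists (p ^ r.+1)%N.
have r_n : (r < n)%N by rewrite nE; apply: ltnW; rewrite ltn_expl// prime_gt1.
have n_gt1 : (1 < n)%N by rewrite nE -(exp1n r.+1) ltn_exp2r// prime_gt1.
have [d [dM d1 d2]] := affine_cocycle amalgam q ('Z_n)^o.
have low := translations_bound qS n_gt1 dM d1 d2.
have pK := cocycle_kernel_p_normal n_gt1 dM pr_p nE cardQ.
have [Q' [q' [qS' qK' [k' cardQ']]]] := p_normal_quotient pK.
have := index_bound_additive qS' cardQ'.
have cQ := card_quotient qS dM qS' qK'.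
rewrite (index_mul (card_image_h1k1 k1 d1 qK') cQ) (index_mul (card_image_h1 d1 qK') cQ).
rewrite (index_mul (card_image_h2 d2 qK') cQ) -/E -/V1 -/V2.
set t := #|translations q d| in low *.
have t_n : (n <= t)%N.
  rewrite -(leq_pmul2r (_ : 0 < n ^ (V1 + V2))%N) ?expn_gt0 ?(ltnW n_gt1)//.
  by apply: leq_trans low; rewrite -expnS leq_exp2l.
rewrite leqNgt -mulnDl => /negP; apply.
have : ((V1 + V2).+1 * t <= E * t)%N by rewrite leq_mul2r lt orbT.
apply: leq_trans; rewrite mulSn addnC ltn_add2r.
exact: leq_trans r_n t_n.
Qed.

End EulerCharacteristic.

(** * Bounded generation from index two *)

Lemma range_subgroup (G H : groupType) (f : G -> H) : {morph f : x y / x * y} ->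
  subgroup (range f).
Proof.
move=> /hom_pack[g gE]; have -> : range f = range g by congr image; apply/funext => x; rewrite gE.
split=> [|_ _ [x _ <-] [y _ <-]]; first by exists 1; rewrite ?gmulf1.
by exists (x / y); rewrite // gmulfF.
Qed.

Lemma bounded_completion_quotients p (G : groupType) :
  boundedly_generated (pro_p_completion p G) -> exists r, bounded_p_quotients p G r.
Proof.
move=> [r [g gP]]; exists r => N pN; pose N' := p_normal_pack pN.
have /choice[a aP] (i : 'I_r) : exists a, component (g i) N' a by exact: component_ex.
exists a => x; have [y yg xy] := gP (completion_unit p x).
have /choice[z zP] (i : 'I_r) : exists z, powers (a i) z /\ component (y i) N' z.
  have [t [gt ty]] := yg i _ (near_component (y i) N').
  case: gt ty => -[n _ <-] ty.
    by exists (a i ^+ n); split; [left; exists n|rewrite -ty; exact: component_expr].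
  exists (a i ^- n); split; first by right; exists n.
  by rewrite -ty; apply: component_invr; exact: component_expr.
exists z; split=> [i|]; first exact: (zP i).1.
apply/(component_eqP (component_unit x N') _).1: (erefl (component (completion_unit p x) N')).
rewrite xy; apply: (big_ind2 (fun u v => component u N' v)) => [|u v u' v'|i _].
- by apply/component_one; case: (subgroup_p_normal N').
- exact: component_mulr.
- exact: (zP i).2.
Qed.

Section ClosedRange.
Variables (p : nat) (pr_p : prime p) (K H : groupType) (k : group_hom K H).
Local Notation khat := (completion_map pr_p k).

Lemma completion_map_range_subgroup : subgroup (range khat).
Proof. by apply: range_subgroup; exact: (completion_map_hom pr_p k).2. Qed.

(** The range is compact, hence closed. *)
Lemma completion_map_range x : (forall N, exists a, component x N (k a)) -> range khat x.
Proof.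
move=> xk; have cr : compact (range khat).
  apply: continuous_compact; last exact: completion_compact.
  exact/continuous_subspaceT/(completion_map_hom pr_p k).1.
apply: (compact_closed (completion_hausdorff pr_p (G := H)) cr).
move=> A /(nbhs_completionP pr_p)[N NA]; have [a xa] := xk N.
exists (khat (completion_unit p a)); split; first by exists (completion_unit p a).
apply: NA; rewrite /completion_ball /= completion_map_unit.
by apply/(component_eqP (component_unit (k a) N) xa); rewrite mulVg; case: (subgroup_p_normal N).
Qed.

Lemma completion_map_avoid x : ~ range khat x ->
  exists2 N : set H, p_normal p N & forall (M : p_normal_subgroup p H) g a,
    set_val M `<=` N -> component x M g -> ~ N ((k a)^-1 * g).
Proof.
move=> nx; apply: contrapT => nN; apply: nx; apply: completion_map_range => N.
apply: contrapT => na; apply: nN; exists (set_val N); first exact: p_normal_subgroupP.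
move=> M g a MN xg Na; apply: na; exists a.
have xgN := component_sub MN xg.
rewrite (component_lcoset xgN); apply/mem_lcoset.
by have := subgroupV (subgroup_p_normal N) Na; rewrite invgM invgK.
Qed.

End ClosedRange.

Lemma index2_complement_mem (Q : finGroupType) (B P : {group Q}) x y :
  #|P : B| = 2 -> x \in P -> y \in P -> x \notin B -> y \notin B ->
  x^-1 * y \in B.
Proof.
move=> iPB Px Py nBx nBy; apply: contraT => nxy.
have ne z w : z^-1 * w \notin B -> (w *: B)%g != (z *: B)%g.
  by apply: contra => /eqP/lcoset_eqP; rewrite fingroup.mem_lcoset.
have mem z : z \in P -> (z *: B)%g \in lcosets B P by move=> Pz; apply/lcosetsP; exists z.
have u : uniq [:: (y *: B)%g; (x *: B)%g; (1 *: B)%g].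
  by rewrite /= !inE negb_or !ne// invg1 mul1g.
have : (size [:: (y *: B)%g; (x *: B)%g; (1 *: B)%g] <= size (enum (lcosets B P)))%N.
  apply: uniq_leq_size u _ => z; rewrite !inE mem_enum.
  by case/or3P => /eqP->; exact: mem.
by rewrite -cardE card_lcosets iPB.
Qed.

Section IndexTwoSufficient.
Variables (p : nat) (pr_p : prime p) (K H1 H2 Gam : groupType).
Variables (k1 : group_hom K H1) (k2 : group_hom K H2).
Variables (h1 : group_hom H1 Gam) (h2 : group_hom H2 Gam).
Hypothesis amalgam : amalgamated_free_product k1 k2 h1 h2.
Local Notation k1hat := (completion_map pr_p k1).
Local Notation k2hat := (completion_map pr_p k2).
Local Notation h1hat := (completion_map pr_p h1).
Local Notation h2hat := (completion_map pr_p h2).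

Lemma completed_comm x : h1hat (k1hat x) = h2hat (k2hat x).
Proof.
apply: (completion_hom_ext (f := h1hat \o k1hat) (g := h2hat \o k2hat) pr_p
  (completion_pro_p pr_p Gam)) => [y|y|a].
- by apply: continuous_comp; [exact: (completion_map_hom pr_p k1).1|exact: (completion_map_hom pr_p h1).1].
- by apply: continuous_comp; [exact: (completion_map_hom pr_p k2).1|exact: (completion_map_hom pr_p h2).1].
by rewrite /= !completion_map_unit; congr completion_unit; exact: (amalg_comm amalgam).
Qed.

(** Modulo the normal subgroup [N] coming from [K], the two factors become groups of order 2, so the
    abstract group lies in the dihedral set of [N] and two elements [a] and [b] outside [N];
    this adds the procyclic groups of [a * b] and [a] to those of [K]. *)
Lemma index2_bounded (s : seq (pro_p_completion p K)) : (forall x, closed_product s x) ->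
  has_index setT (range k1hat) 2 -> has_index setT (range k2hat) 2 ->
  boundedly_generated (pro_p_completion p Gam).
Proof.
move=> sK i1 i2.
have sA1 := completion_map_range_subgroup pr_p k1; have sA2 := completion_map_range_subgroup pr_p k2.
have [a [na aP]] := index2_complement sA1 i1; have [b [nb bP]] := index2_complement sA2 i2.
have [nA1 /(_ na) aa] := index2_normal sA1 aP; have [nA2 /(_ nb) bb] := index2_normal sA2 bP.
have [_ _ cA1] := nA1; have [_ _ cA2] := nA2.
have [h1h h1E] := hom_pack (completion_map_hom pr_p h1).2.
have [h2h h2E] := hom_pack (completion_map_hom pr_p h2).2.
pose phi x := h1hat (k1hat x).
have phi_hom : continuous_hom phi.
  split=> [x|x y]; last by rewrite /phi (completion_map_hom pr_p k1).2 (completion_map_hom pr_p h1).2.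
  by apply: continuous_comp; [exact: (completion_map_hom pr_p k1).1|exact: (completion_map_hom pr_p h1).1].
pose N := range phi.
have sN : subgroup N by apply: range_subgroup; case: phi_hom.
have N1 y : range k1hat y -> N (h1hat y) by move=> [x _ <-]; exists x.
have N2 y : range k2hat y -> N (h2hat y) by move=> [x _ <-]; exists x => //; exact: completed_comm.
have norm1 y n : N n -> N (n ^ h1hat y).
  move=> [x _ <-]; rewrite /phi -!h1E -gmulfJ h1E; apply: N1; exact: cA1.
have norm2 y n : N n -> N (n ^ h2hat y).
  move=> [x _ <-]; rewrite /phi completed_comm -!h2E -gmulfJ h2E; apply: N2; exact: cA2.
pose T := [set x | forall n, N (n ^ x) <-> N n].
have T1 y : T (h1hat y).
  move=> n; split; last exact: norm1.
  by move=> /(norm1 y^-1); rewrite -[h1hat y^-1]h1E gmulfV h1E conjgK.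
have T2 y : T (h2hat y).
  move=> n; split; last exact: norm2.
  by move=> /(norm2 y^-1); rewrite -[h2hat y^-1]h2E gmulfV h2E conjgK.
have NT : N `<=` T by move=> _ [x _ <-]; exact: T1.
have Naa : N (h1hat a * h1hat a) by rewrite -(completion_map_hom pr_p h1).2; exact: N1.
have Nbb : N (h2hat b * h2hat b) by rewrite -(completion_map_hom pr_p h2).2; exact: N2.
pose D := dihedral_set N (h1hat a) (h2hat b).
have stable t x : N t \/ t = h1hat a \/ t = h2hat b -> D (t * x) <-> D x.
  exact: (dihedral_stable sN Naa Nbb NT (T1 a) (T2 b)).
have stable1 y x : D (h1hat y * x) <-> D x.
  have [Ay|Ay] := aP y; first by apply: stable; left; exact: N1.
  rewrite -(mulVKg a y) (completion_map_hom pr_p h1).2 -mulgA (stable (h1hat a)); last by right; left.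
  by apply: stable; left; exact: N1.
have stable2 y x : D (h2hat y * x) <-> D x.
  have [Ay|Ay] := bP y; first by apply: stable; left; exact: N2.
  rewrite -(mulVKg b y) (completion_map_hom pr_p h2).2 -mulgA (stable (h2hat b)); last by right; right.
  by apply: stable; left; exact: N2.
have [u uE] := hom_pack (@completion_unitM p Gam).
have Dunit g : D (completion_unit p g).
  have D1 : D 1 by exists 1; [left; exists 0%N|left; rewrite mulg1 invg1; case: sN].
  suff : forall x, D (u g * x) <-> D x by move=> /(_ 1) [_ /(_ D1)]; rewrite mulg1 uE.
  apply: (amalgam_generated amalgam (S := [set g | forall x, D (u g * x) <-> D x])).
  - split=> [x|y z Sy Sz x]; first by rewrite gmulf1 mul1g.
    rewrite gmulfM -mulgA (Sy _) gmulfV.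
    by rewrite -(Sz _) mulVKg.
  - by move=> h x; rewrite uE -(completion_map_unit pr_p).
  - by move=> h x; rewrite uE -(completion_map_unit pr_p).
apply: (@closed_product_bounded _ (map phi s ++ [:: h1hat a * h2hat b; h1hat a])).
apply: completion_closed_product => // g.
have [n [w [e [[x _ <-] pw e1a ->]]]] := dihedral_factor sN NT (T1 a) (T2 b) (Dunit g).
apply: closed_product_cat; first exact: closed_product_map.
rewrite -cat1s; apply: closed_product_cat; first exact: closed_product_powers.
case: e1a => ->; first exact: closed_product1.
by apply: closed_product_powers; left; exists 1%N.
Qed.

End IndexTwoSufficient.

(** * Index two from bounded generation *)

Section IndexTwoNecessary.
Variables (p : nat) (pr_p : prime p) (K H1 H2 Gam : groupType).
Variables (k1 : group_hom K H1) (k2 : group_hom K H2).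
Variables (h1 : group_hom H1 Gam) (h2 : group_hom H2 Gam).
Hypothesis amalgam : amalgamated_free_product k1 k2 h1 h2.

(** Write [e1] and [e2] for the indices of the image of [K] in those of [H1] and [H2] in a finite
    p-quotient where both are larger than 1.  Dividing [index_bound] by the index of the image of [K] gives
    [1 <= 1 / e1 + 1 / e2], so that both indices equal 2. *)
Lemma quotient_index2 r (L : set Gam) w1 w2 : bounded_p_quotients p Gam r -> p_normal p L ->
  (forall a, ~ L (h1 ((k1 a)^-1 * w1))) -> (forall a, ~ L (h2 ((k2 a)^-1 * w2))) ->
  p = 2 /\ forall x y : H1, (forall a, ~ L (h1 ((k1 a)^-1 * x))) ->
    (forall a, ~ L (h1 ((k1 a)^-1 * y))) -> exists a, L (h1 ((k1 a)^-1 * (x^-1 * y))).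
Proof.
move=> bdd pL n1 n2; have [Q [q [qS qK [k cardQ]]]] := p_normal_quotient pL.
have le := index_bound amalgam pr_p bdd qS cardQ.
set B := image_group (q \o h1 \o k1) in le.
set P1 := image_group (q \o h1) in le; set P2 := image_group (q \o h2) in le.
have qE (H : groupType) (h : group_hom H Gam) u v : L (h (u^-1 * v)) <-> q (h u) = q (h v).
  rewrite -qK !gmulfM !gmulfV; split=> [/(congr1 (mulg (q (h u))))|->]; last by rewrite mulVg.
  by rewrite mulVKg mulg1.
have memB x : reflect (exists a, L (h1 ((k1 a)^-1 * x))) (q (h1 x) \in B).
  by apply: (iffP (image_groupP _ _)) => -[a e]; exists a; apply/qE.
have nB x : (forall a, ~ L (h1 ((k1 a)^-1 * x))) -> q (h1 x) \notin B.
  by move=> nx; apply/memB => -[a /nx].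
have BP1 : B \subset P1.
  by apply/fintype.subsetP => _ /image_groupP[a <-]; exact: (mem_image_group (q \o h1)).
have comm a : q (h1 (k1 a)) = q (h2 (k2 a)) by congr (q _); exact: (amalg_comm amalgam a).
have BP2 : B \subset P2.
  apply/fintype.subsetP => _ /image_groupP[a <-] /=; rewrite comm.
  exact: (mem_image_group (q \o h2)).
have e1 : (1 < #|P1 : B|)%N.
  rewrite indexg_gt1; apply/negP => /fintype.subsetP sub.
  by have := nB _ n1; rewrite sub//; exact: (mem_image_group (q \o h1)).
have e2 : (1 < #|P2 : B|)%N.
  rewrite indexg_gt1; apply/negP => /fintype.subsetP sub.
  have /sub/image_groupP[a /=] := mem_image_group (q \o h2) w2.
  by rewrite comm => /qE; exact: n2.
have E1 := Lagrange_index (finset.subsetT P1) BP1.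
have E2 := Lagrange_index (finset.subsetT P2) BP2.
have B_gt0 : (0 < #|[set: Q]%SET : B|)%N := indexg_gt0 _ _.
have i2 : #|P1 : B| = 2.
  have l2 : (#|[set: Q]%SET : P2| * 2 <= #|[set: Q]%SET : B|)%N by rewrite -E2 leq_mul2l e2 orbT.
  apply/eqP; rewrite eqn_leq e1 andbT leqNgt; apply/negP => e3.
  have l1 : (#|[set: Q]%SET : P1| * 3 <= #|[set: Q]%SET : B|)%N by rewrite -E1 leq_mul2l e3 orbT.
  lia.
split; last first.
  move=> x y nx ny; apply/memB; rewrite gmulfM gmulfV gmulfM gmulfV.
  apply: (index2_complement_mem i2); [| |exact: nB|exact: nB];
    exact: (mem_image_group (q \o h1)).
have : (2 %| p ^ k)%N.
  rewrite -cardQ -cardsT -i2; apply: dvdn_trans (cardSg (finset.subsetT P1)).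
  exact: dvdn_indexg.
by rewrite Euclid_dvdX// dvdn_prime2// => /andP[/eqP].
Qed.

Local Notation k1hat := (completion_map pr_p k1).
Local Notation k2hat := (completion_map pr_p k2).

(** Failure of index 2 for the completions is visible in some finite p-quotient of [H1]; since [H1] is
    embedded, it is visible in a finite p-quotient of the amalgam. *)
Lemma bounded_index2 : p_embedded p (range h1) -> p_embedded p (range h2) ->
  boundedly_generated (pro_p_completion p Gam) ->
  range k1hat `<` setT -> range k2hat `<` setT ->
  p = 2 /\ has_index setT (range k1hat) 2.
Proof.
move=> emb1 emb2 /bounded_completion_quotients[r bdd] [_ n1] [_ n2].
have /existsNP[x1 nx1] : ~ forall x, range k1hat x by move=> s; apply: n1 => x _; exact: s.
have /existsNP[x2 nx2] : ~ forall x, range k2hat x by move=> s; apply: n2 => x _; exact: s.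
have sR := completion_map_range_subgroup pr_p k1.
have cof1 := embedded_cofinal pr_p (amalgam_inj1 amalgam) emb1.
have cof2 := embedded_cofinal pr_p (amalgam_inj1 (amalgam_sym amalgam)) emb2.
have [N1 pN1 av1] := completion_map_avoid nx1; have [N2 pN2 av2] := completion_map_avoid nx2.
have [M1 pM1 MN1] := cof1 _ pN1; have [M2 pM2 MN2] := cof2 _ pN2.
have main x y : ~ range k1hat x -> ~ range k1hat y -> p = 2 /\ range k1hat (x^-1 * y).
  move=> nx ny.
  have [Nx pNx avx] := completion_map_avoid nx; have [Ny pNy avy] := completion_map_avoid ny.
  suff main' (N' : set H1) : p_normal p N' -> p = 2 /\
      exists (M : p_normal_subgroup p H1) g a, [/\ set_val M `<=` N',
        component (x^-1 * y) M g & N' ((k1 a)^-1 * g)].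
    split; first by case: (main' _ (p_normalT pr_p H1)).
    apply: contrapT => nxy; have [N' pN' av] := completion_map_avoid nxy.
    have [_ [M [g [a [MN' Mg N'a]]]]] := main' _ pN'.
    exact: av MN' Mg N'a.
  move=> pN'; have [Mx pMx MNx] := cof1 _ pNx; have [My pMy MNy] := cof1 _ pNy.
  have [M' pM' MN'] := cof1 _ pN'.
  (* [L] is small enough to separate [x1], [x2], [x] and [y] from [K], and to approximate
     [x^-1 * y] modulo [N'] *)
  pose L := (M1 `&` M2) `&` ((Mx `&` My) `&` M').
  have pL : p_normal p L by do ![apply: p_normalI => //].
  pose L1 := p_normal_pullback pr_p h1 (p_normal_pack pL).
  pose L2 := p_normal_pullback pr_p h2 (p_normal_pack pL).
  have [w1 xw1] := component_ex x1 L1; have [w2 xw2] := component_ex x2 L2.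
  have [u xu] := component_ex x L1; have [v yv] := component_ex y L1.
  have [||p2 conc] := @quotient_index2 r L w1 w2 bdd pL.
  - move=> a [[La _] _]; apply: av1 xw1 _; last by apply: MN1; exact: La.
    by move=> z [[Lz _] _]; exact: MN1.
  - move=> a [[_ La] _]; apply: av2 xw2 _; last by apply: MN2; exact: La.
    by move=> z [[_ Lz] _]; exact: MN2.
  split=> //; have [||a La] := conc u v.
  - move=> a [_ [[La _] _]]; apply: avx xu _; last by apply: MNx; exact: La.
    by move=> z [_ [[Lz _] _]]; exact: MNx.
  - move=> a [_ [[_ La] _]]; apply: avy yv _; last by apply: MNy; exact: La.
    by move=> z [_ [[_ Lz] _]]; exact: MNy.
  exists L1, (u^-1 * v), a; split.
  - by move=> z [_ [_ Lz]]; exact: MN'.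
  - exact: component_mulr (component_invr xu) yv.
  - by apply: MN'; case: La => _ [].
split; first by case: (main x1 x1 nx1 nx1).
apply: (complement_index2 sR nx1) => x.
have [?|nx] := EM (range k1hat x); first by left.
by right; case: (main x1 x nx1 nx).
Qed.

End IndexTwoNecessary.

Theorem corollary6p3 (p : nat) (pr_p : prime p)
    (K H1 H2 Gam : groupType)
    (k1 : group_hom K H1) (k2 : group_hom K H2)
    (h1 : group_hom H1 Gam) (h2 : group_hom H2 Gam)
    (Gam_amalgam : amalgamated_free_product k1 k2 h1 h2)
    (fg_H1 : finitely_generated H1) (nil_H1 : nilpotent_group H1)
    (fg_H2 : finitely_generated H2) (nil_H2 : nilpotent_group H2) :
  let Khat := pro_p_completion p K in
  let H1hat := pro_p_completion p H1 in
  let H2hat := pro_p_completion p H2 in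
  let Gamhat := pro_p_completion p Gam in
  let k1hat : Khat -> H1hat := completion_map pr_p k1 in
  let k2hat : Khat -> H2hat := completion_map pr_p k2 in
  let h1hat : H1hat -> Gamhat := completion_map pr_p h1 in
  let h2hat : H2hat -> Gamhat := completion_map pr_p h2 in
  [/\ p_virtual_retract p (range h1) -> p_embedded p (range h1),
      p_virtual_retract p (range h2) -> p_embedded p (range h2) &
      p_embedded p (range h1) -> p_embedded p (range h2) ->
      [/\ proper_pro_p_amalgam p k1hat k2hat h1hat h2hat,
          range k1hat `<` [set: H1hat] -> range k2hat `<` [set: H2hat] ->
          (boundedly_generated Gamhat <->
           [/\ boundedly_generated Khat, p = 2,
               has_index [set: H1hat] (range k1hat) 2 &
               has_index [set: H2hat] (range k2hat) 2]) &
          p = 2 ->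
          has_index [set: H1hat] (range k1hat) 2 ->
          has_index [set: H2hat] (range k2hat) 2 ->
          boundedly_generated Khat]].
Proof.
move=> Khat H1hat H2hat Gamhat k1hat k2hat h1hat h2hat.
have k1I := amalg_inj1 Gam_amalgam; have k2I := amalg_inj2 Gam_amalgam.
have sym := amalgam_sym Gam_amalgam.
have range_sub (G H : groupType) (f : group_hom G H) : subgroup (range f).
  by apply: range_subgroup; exact: gmulfM.
have [s sK] : exists s : seq Khat, forall x, closed_product s x.
  apply: polycyclic_completion => //; rewrite -(preimage_setT k1).
  by apply: polycyclic_preimage => //; exact: nilpotent_polycyclic.
have bK : boundedly_generated Khat := closed_product_bounded sK.
split=> [||emb1 emb2]; try exact: p_virtual_retract_embedded.
split=> [|n1 n2|//].
  split.
  - apply: completed_amalgam => //; apply: completion_map_inj; apply: embedded_cofinal => //.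
      exact: nilpotent_p_embedded.
    exact: nilpotent_p_embedded.
  - apply: completion_map_inj; apply: embedded_cofinal => //; exact: (amalgam_inj1 Gam_amalgam).
  - apply: completion_map_inj; apply: embedded_cofinal => //; exact: (amalgam_inj1 sym).
split=> [bG|[_ _ i1 i2]]; last exact: (index2_bounded Gam_amalgam sK i1 i2).
have [p2 i1] := bounded_index2 Gam_amalgam emb1 emb2 bG n1 n2.
by have [_ i2] := bounded_index2 sym emb2 emb1 bG n2 n1.
Qed.
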